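(* Let $\overline\nu$ be a partition of $d$. Then there is a rational piecewise polynomial function $s_{\overline\nu}:[0,\infty)\to\mathbb R$ such that for all $k\ge t(\overline\nu)$ $$ {\sf g}(\rho_k,\rho_k,(n_k-d,\overline\nu)) = s_{\overline\nu}(k). $$ Moreover, $s_{\overline\nu}$ is a polynomial function of degree $d$ in the interval $[c(\overline\nu),\infty)$ with leading coefficient $f^{\overline\nu}$.
   Context: ${\sf g}(\lambda,\mu,\nu)=\langle\chi^\lambda\otimes\chi^\mu,\chi^\nu\rangle$ is the Kronecker coefficient, with $\chi^\lambda$ the irreducible character of ${\sf S}_n$ attached to the partition $\lambda$ of $n$. For a positive integer $k$, $\rho_k=(k,k-1,\dots,2,1)$ is the staircase partition, of size $n_k=\binom{k+1}{2}$; $k$ ranges over positive integers. For $\overline\nu=(\nu_2,\dots,\nu_r)\vdash d$, $(n_k-d,\overline\nu)=(n_k-d,\nu_2,\dots,\nu_r)$ ($\nu_2=0$ if $\overline\nu$ is empty). $t(\overline\nu)$ is the smallest integer greater than or equal to $\frac{-1+\sqrt{1+8(\nu_2+d)}}{2}$ (so $(n_k-d,\overline\nu)$ is a partition of $n_k$ if and only if $k\ge t(\overline\nu)$), and $c(\overline\nu)=\max\{d-1,t(\overline\nu)\}$. $f^{\overline\nu}$ is the number of standard Young tableaux of shape $\overline\nu$. A piecewise polynomial function is a continuous function $f:[0,\infty)\to\mathbb R$ for which there is a finite sequence $0=x_0<x_1<\cdots<x_\ell=\infty$, $\ell\ge1$, such that the restriction of $f$ to each interval with endpoints $x_{i-1},x_i$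 (closed at finite endpoints) is a polynomial function; it is rational if these polynomials have rational coefficients. *)

(* Defs.v *)
From HB Require Import structures.
From mathcomp Require Import all_boot all_order all_algebra all_fingroup.
From mathcomp Require Import all_solvable all_field all_character.
From mathcomp Require Import all_classical all_reals.
From mathcomp Require Import ereal topology normedtype.

Set Implicit Arguments.
Unset Strict Implicit.
Unset Printing Implicit Defensive.

Import Order.TTheory GRing.Theory Num.Theory.
Import numFieldNormedType.Exports.

Local Open Scope classical_set_scope.
Local Open Scope ring_scope.

Definition is_partition (n : nat) (la : seq nat) : bool :=
  [&& sorted geq la, 0%N \notin la & sumn la == n].

(* The cells of the Young diagram of la |- n are numbered 0, ..., n - 1 row by
   row: the cell numbered i lies in row [reshape_index la i] and in column
   [reshape_offset la i] (both counted from 0). *)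
Definition same_row (la : seq nat) (i j : nat) : bool :=
  reshape_index la i == reshape_index la j.

Definition same_col (la : seq nat) (i j : nat) : bool :=
  reshape_offset la i == reshape_offset la j.

Definition row_stab (n : nat) (la : seq nat) : {set 'S_n} :=
  [set s : 'S_n | [forall i : 'I_n, same_row la (s i) i]]%SET.

Definition col_stab (n : nat) (la : seq nat) : {set 'S_n} :=
  [set s : 'S_n | [forall i : 'I_n, same_col la (s i) i]]%SET.

(* The Young symmetrizer of the row-reading tableau, an element of the group
   algebra of 'S_n realized by matrices through the right regular
   representation; [odd_perm] gives the signature. *)
Definition young_symmetrizer (n : nat) (la : seq nat) : 'M[algC]_#|[set: 'S_n]%G| :=
  let aG := regular_repr algC [set: 'S_n]%G in
  (\sum_(s in row_stab n la) aG s)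
    *m (\sum_(s in col_stab n la) (-1) ^+ odd_perm s *: aG s).

(* The Specht module of la, as the right ideal of the group algebra generated
   by the Young symmetrizer. *)
Definition specht_mx (n : nat) (la : seq nat) : 'M[algC]_#|[set: 'S_n]%G| :=
  cyclic_mx (regular_repr algC [set: 'S_n]%G)
            (gring_row (young_symmetrizer n la)).

Lemma specht_mx_module (n : nat) (la : seq nat) :
  mxmodule (regular_repr algC [set: 'S_n]%G) (specht_mx n la).
Proof. exact: cyclic_mx_module. Qed.

Definition specht_char (n : nat) (la : seq nat) : 'CF([set: 'S_n]%G) :=
  cfRepr (submod_repr (specht_mx_module n la)).

(* The truncation only moves the inner product from algC to nat: see
   [kroneckerE]. *)
Definition kronecker (n : nat) (la mu nu : seq nat) : nat :=
  Num.truncn '[specht_char n la * specht_char n mu, specht_char n nu].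

Lemma kroneckerE (n : nat) (la mu nu : seq nat) :
  (kronecker n la mu nu)%:R
  = '[specht_char n la * specht_char n mu, specht_char n nu].
Proof. by rewrite truncnK // Cnat_cfdot_char ?rpredM // cfRepr_char. Qed.

Definition staircase (k : nat) : seq nat := rev (iota 1 k).

Definition staircase_size (k : nat) : nat := 'C(k.+1, 2).

(* A filling of the diagram by 0, ..., d - 1 is a permutation of 'I_d sending
   the number of a cell to its entry. *)
Definition is_syt (d : nat) (la : seq nat) (T : 'S_d) : bool :=
  [forall i : 'I_d, forall j : 'I_d,
     (same_row la i j && (reshape_offset la i < reshape_offset la j)%N
        ==> (T i < T j)%N) &&
     (same_col la i j && (reshape_index la i < reshape_index la j)%N
        ==> (T i < T j)%N)].

Definition num_syt (d : nat) (la : seq nat) : nat :=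
  #|[set T : 'S_d | is_syt la T]%SET|.

Definition t_bound (R : realType) (d : nat) (nu : seq nat) : int :=
  Num.ceil ((-1 + Num.sqrt (1 + 8 * (head 0%N nu + d)%:R)) / 2 : R).

Definition c_bound (R : realType) (d : nat) (nu : seq nat) : int :=
  Num.max (d%:Z - 1) (t_bound R d nu).

(* Functions on [0, +oo) are represented by functions on R, whose values at
   negative arguments are irrelevant. The breakpoints are x 0, ..., x l. *)
Definition rational_piecewise_poly (R : realType) (f : R -> R) : Prop :=
  {within `[0, +oo[, continuous f} /\
  exists (l : nat) (x : nat -> \bar R) (p : nat -> {poly rat}),
    [/\ (1 <= l)%N,
        x 0%N = 0%:E /\ x l = +oo%E,
        forall i, (i < l)%N -> (x i < x i.+1)%E
      & forall i, (i < l)%N -> forall y : R, (x i <= y%:E <= x i.+1)%E ->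
          f y = (map_poly ratr (p i)).[y]].

(* Main.v *)
Require Import Defs.
From mathcomp Require Import all_boot all_order all_algebra all_fingroup.
From mathcomp Require Import all_field all_character.
From mathcomp Require Import zify ring lra.

Set Implicit Arguments.
Unset Strict Implicit.
Unset Printing Implicit Defensive.

Import Order.TTheory GRing.Theory Num.Theory.

Local Open Scope ring_scope.

(** Let rho be the staircase partition with k rows and n cells.

    Frobenius' formula ([specht_char_frob]) expresses the character of a Specht
    module at a permutation s as a signed count of the colourings fixed by s:
    it is a coefficient of the product of the Vandermonde alternant and of the
    power sums of the cycle lengths of s.  Averaging a product of three such
    counts over the symmetric group leaves, by Burnside's lemma
    ([burnside_content]), one term for each three-dimensional array of natural
    numbers, weighted by alternant coefficients of its three margins.

    For (n - d, nu) the slice of the array that belongs to the long row is a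
    k x k matrix, and the sum over this slice is given by the orthogonality of
    alternants ([alternant_orthogonality], a form of Cauchy's determinant
    identity).  What remains ([alt_array_split]) is a sum over the partitions
    alpha contained in rho with at most d cells of rho outside alpha, each
    contributing a number that depends on the skew shape rho / alpha only.  The
    row lengths of this skew shape, read from the bottom, form a word e with
    e_0 <= 1 and e_(i+1) <= e_i + 1, and every such word occurs.

    An empty row of the skew shape can be deleted without changing its
    contribution ([word_char_strip]).  The Kronecker coefficient is therefore a
    sum over the finitely many words z without zeros whose letters sum to at
    most d: each contributes a constant times the number of ways to insert
    zeros into z so as to obtain a word of length k.  Zeros can be inserted
    before a letter 1 and at the end, so that if z has W letters, j of them
    equal to 1, this number is the binomial coefficient of k - W + j over j
    ([strip_countE]).  It is a polynomial in k as soon as k - W + j >= 0, hence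
    for all k >= d - 1, because W <= d, and j >= 1 unless z is empty.  The
    degree d is reached only for z = 1...1 with d letters, that is, for d
    disconnected cells, and the constant of this word is d! times the degree of
    the character of nu; so the leading coefficient is the number of standard
    tableaux of shape nu ([kron_poly_coef], [num_syt_frob_dim]).

    The finitely many smaller values of k are matched by adding to this
    polynomial multiples of hat functions centred at the integers below
    [c_bound], which vanish on the half-line where the function has to agree
    with the polynomial ([interp]). *)

(** * Colourings, contents and arrays *)

Definition content (X Z : finType) (f : {ffun X -> Z}) : {ffun Z -> nat} :=
  [ffun z => (\sum_x (f x == z))%N].

Definition fixedby (n : nat) (Z : finType) (s : 'S_n) (f : {ffun 'I_n -> Z}) :=
  [forall x, f (s x) == f x].

(** Bounding the entries makes the type of arrays finite, so that one can sum
    over it; [entries] forgets the bound. *)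
Definition entries (Z : finType) N (M : {ffun Z -> 'I_N}) : {ffun Z -> nat} :=
  [ffun z => M z : nat].

Definition mass (Z : finType) (m : Z -> nat) : nat := (\sum_z m z)%N.

Lemma mass_content (X Z : finType) (f : {ffun X -> Z}) :
  mass (content f) = #|X|.
Proof.
rewrite /mass -sum1_card.
under eq_bigr => z _ do rewrite ffunE.
rewrite exchange_big /=; apply: eq_bigr => x _.
by rewrite (bigD1 (f x)) //= eqxx big1 // => z; rewrite eq_sym => /negbTE->.
Qed.

Lemma same_content_perm n (Z : finType) (F G : {ffun 'I_n -> Z}) :
  content F = content G -> exists s : 'S_n, forall x, G x = F (s x).
Proof.
move=> eFG.
pose tF := [tuple F i | i < n]; pose tG := [tuple G i | i < n].
have cE (K : {ffun 'I_n -> Z}) z :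
    count_mem z [tuple K i | i < n] = content K z.
  rewrite ffunE -sum1_count big_map big_mkcond /= enumT.
  by apply: eq_bigr => i _; case: eqP.
have: perm_eq tG tF by rewrite /perm_eq; apply/allP => z _ /=; rewrite !cE eFG.
case/tuple_permP => s es.
exists s => x.
have := congr1 (fun u => nth (F (s x)) u x) es.
rewrite (nth_map x) ?size_enum_ord // nth_ord_enum => ->.
by rewrite (nth_map x) ?size_enum_ord // nth_ord_enum tnth_mktuple.
Qed.

Lemma content_exists n (Z : finType) (m : {ffun Z -> nat}) :
  mass m = n -> exists F : {ffun 'I_n -> Z}, content F = m.
Proof.
move=> tm.
pose u := flatten [seq nseq (m z) z | z <- enum Z].
have su : size u = n.
  rewrite size_flatten /shape -map_comp sumnE big_map -tm /mass enumT.
  by apply: eq_bigr => z _ /=; rewrite size_nseq.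
case: n tm su => [|n] tm su.
  have Z0 z : m z = 0%N.
    by apply/eqP; move/eqP: tm; rewrite /mass sum_nat_eq0 => /forallP/(_ z).
  exists (finfun (fun i : 'I_0 => match i with Ordinal k lt => False_rect Z (notF lt) end)).
  by apply/ffunP => z; rewrite ffunE big_ord0 Z0.
have x0 : Z by case: u su => [|z].
exists [ffun i : 'I_n.+1 => nth x0 u i].
apply/ffunP => z; rewrite ffunE.
have -> : (\sum_(x < n.+1) ([ffun i : 'I_n.+1 => nth x0 u i] x == z) = count_mem z u)%N.
  rewrite -sum1_count (big_nth x0) [RHS]big_mkcond su big_mkord /=.
  by apply: eq_bigr => i _; rewrite ffunE; case: eqP.
rewrite /u count_flatten -map_comp sumnE big_map enumT (bigD1_seq z) //=; last first.
- by rewrite -enumT enum_uniq.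
- by rewrite -enumT mem_enum.
rewrite /= count_nseq /= eqxx mul1n big1 ?addn0 // => y /negbTE ny.
by rewrite count_nseq /= ny.
Qed.

Lemma content_perm (X Z : finType) (f : {ffun X -> Z}) (s : {perm X}) :
  content [ffun x => f (s x)] = content f.
Proof.
apply/ffunP => z; rewrite !ffunE [RHS](reindex_inj (@perm_inj _ s)).
by apply: eq_bigr => x _; rewrite ffunE.
Qed.

(** The permutations that carry a fixed function of content [m] to F form a
    coset of the stabilizer of F, and every permutation carries it somewhere. *)
Lemma orbit_content n (Z : finType) (m : {ffun Z -> nat}) : mass m = n ->
  (\sum_(F : {ffun 'I_n -> Z} | content F == m) #|[set s : 'S_n | fixedby s F]| = n`!)%N.
Proof.
move=> tm; have [F0 cF0] := content_exists tm.
rewrite -[RHS]card_Sn -sum1_card.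
rewrite (partition_big (fun s : 'S_n => [ffun x => F0 (s x)])
  (fun F => content F == m)) /=; last by move=> s _; rewrite content_perm cF0.
apply: eq_bigr => F /eqP cF.
have [s0 es0] : exists s : 'S_n, forall x, F x = F0 (s x).
  by apply: same_content_perm; rewrite cF cF0.
rewrite -sum1_card [RHS](reindex_inj (mulIg s0)) /=.
apply: eq_bigl => s; rewrite inE; apply/forallP/eqP => [h | h x].
  by apply/ffunP => x; rewrite ffunE permM -es0; apply/eqP.
by move/ffunP/(_ x): h; rewrite ffunE permM -es0 => ->.
Qed.

Lemma content_le n (Z : finType) (F : {ffun 'I_n -> Z}) z : (content F z <= n)%N.
Proof.
by rewrite -[n in (_ <= n)%N]card_ord -(mass_content F) /mass (bigD1 z) //= leq_addr.
Qed.

(** Burnside's lemma: the functions with a given content form a single orbit, so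
    that each content is counted [n`!] times. *)
Lemma burnside_content n N (Z : finType) (H : {ffun Z -> nat} -> int) :
  (n < N)%N ->
  \sum_(s : 'S_n) \sum_(F : {ffun 'I_n -> Z} | fixedby s F) H (content F)
  = n`!%:R * \sum_(M : {ffun Z -> 'I_N} | mass (entries M) == n) H (entries M).
Proof.
case: N => // N ltnN.
rewrite (exchange_big_dep predT) //=.
rewrite (partition_big (fun F : {ffun 'I_n -> Z} => [ffun z => inord (content F z) : 'I_N.+1])
  (fun M => mass (entries M) == n)) /=; last first.
  move=> F _; rewrite -[X in _ == X](card_ord n) -(mass_content F).
  apply/eqP/eq_bigr => z _; rewrite ffunE [in LHS]ffunE inordK //.
  exact: leq_ltn_trans (content_le F z) ltnN.
rewrite mulr_sumr; apply: eq_bigr => M /eqP tM.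
rewrite -(orbit_content tM) natr_sum mulr_suml.
have cE (F : {ffun 'I_n -> Z}) :
   ([ffun z => inord (content F z)] == M) = (content F == entries M).
  apply/eqP/eqP => [<-|cF].
    apply/ffunP => z; rewrite [RHS]ffunE ffunE inordK //.
    exact: leq_ltn_trans (content_le F z) ltnN.
  by apply/ffunP => z; rewrite ffunE cF ffunE inord_val.
rewrite (eq_bigl _ _ cE); apply: eq_bigr => F /eqP ->.
rewrite -sum1_card natr_sum mulr_suml.
by apply: eq_big => [s|s _]; rewrite ?inE ?mul1r.
Qed.

(** * Alternants *)

Lemma card_below (X : finType) (P : pred X) (h : X -> nat) m :
  {in P &, injective h} -> (#|[pred y | P y && (h y < m)%N]| <= m)%N.
Proof.
move=> injh; rewrite cardE -(size_map h) -[m in (_ <= m)%N](size_iota 0).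
apply: uniq_leq_size.
  rewrite map_inj_in_uniq ?enum_uniq // => y z.
  by rewrite !mem_enum !inE => /andP[Py ly] /andP[Pz lz]; apply: injh.
by move=> x /mapP[y]; rewrite mem_enum inE => /andP[_ ltm] ->; rewrite mem_iota.
Qed.

(** A pair of distinct related points is counted at the point where [h] is
    larger.  The count is thus the same for all [h] that separate related points,
    which is how two such functions will be compared. *)
Lemma sum_rank (X : finType) (Q : rel X) (h : X -> nat) :
  symmetric Q -> (forall x y, Q x y -> h x = h y -> x = y) ->
  ((\sum_x #|[pred y | Q x y && (h y < h x)]|).*2
    = \sum_x #|[pred y | Q x y && (y != x)]|)%N.
Proof.
move=> symQ injh; rewrite -addnn.
have E (S : X -> pred X) : (\sum_x #|S x| = \sum_x \sum_y (y \in S x))%N.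
  by apply: eq_bigr => x _; rewrite -sum1_card big_mkcond.
rewrite !E {2}exchange_big -big_split /=; apply: eq_bigr => x _.
rewrite -big_split; apply: eq_bigr => y _ /=; rewrite /in_mem /= (symQ y).
case Qxy: (Q x y) => //=; case: (eqVneq y x) => [->|nyx] /=.
  by rewrite !ltnn.
have nh : h y != h x by apply: contra nyx => /eqP /esym /(injh _ _ Qxy) ->.
by case: ltngtP nh.
Qed.

Local Notation delta := (fun i => nat_of_ord i).

Section Alternant.

Variable k : nat.
Implicit Types b c : 'I_k -> nat.

(** The coefficient of X^(c - x) in the alternant of the exponents [b], that is,
    in the sum over w of the sign of w times X^(b o w). *)
Definition alt_coef b c (x : 'I_k -> nat) : int :=
  \sum_(w : 'S_k | [forall i, x i + b (w i) == c i]%N) (-1) ^+ w.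

Lemma eq_alt_coef b b' c c' (x x' : 'I_k -> nat) : b =1 b' -> c =1 c' -> x =1 x' ->
  alt_coef b c x = alt_coef b' c' x'.
Proof.
move=> eb ec ex; apply: eq_bigl => w; apply: eq_forallb => i.
by rewrite eb ec ex.
Qed.

Lemma int_eq_opp0 (a : int) : a = - a -> a = 0.
Proof. lia. Qed.

Lemma odd_tperm_sign (i j : 'I_k) (w : 'S_k) : i != j ->
  (-1) ^+ (w * tperm i j)%g = - (-1) ^+ w :> int.
Proof. by move=> nij; rewrite odd_permM odd_tperm nij addbT signrN. Qed.

Lemma alt_eq0_l b c (x : 'I_k -> nat) i j : i != j -> b i = b j -> alt_coef b c x = 0.
Proof.
move=> nij eb; apply: int_eq_opp0.
rewrite {1}/alt_coef (reindex_inj (mulIg (tperm i j))) -sumrN /=.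
apply: eq_big => [w|w _]; last exact: odd_tperm_sign.
apply: eq_forallb => y; rewrite permM.
by congr (_ + _ == _)%N; case: tpermP => [->|->|].
Qed.

Lemma alt_eq0_r b c (x : 'I_k -> nat) i j : i != j -> c i = c j -> x i = x j ->
  alt_coef b c x = 0.
Proof.
move=> nij ec ex; apply: int_eq_opp0.
rewrite {1}/alt_coef (reindex_inj (mulgI (tperm i j))) -sumrN /=.
apply: eq_big => [w|w _].
  apply/forallP/forallP => h y; have := h (tperm i j y); rewrite permM ?tpermK;
  by case: (tpermP i j y) => [->|->|]; rewrite ?ec ?ex.
by rewrite odd_permM odd_tperm nij addTb signrN.
Qed.

(** The determinant of the matrix with entry 1 where [c i = b j] and 0 elsewhere. *)
Definition rearr_sign c b : int := alt_coef b c (fun=> 0%N).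

Lemma sum_ord_nat : (\sum_(i < k) i = 'C(k, 2))%N.
Proof. by rewrite -triangular_sum big_mkord. Qed.

Lemma sum_rank_inj b : injective b ->
  (\sum_i #|[pred j | b j < b i]| = 'C(k, 2))%N.
Proof.
move=> injb; apply: double_inj.
have := @sum_rank _ (fun _ _ => true) b.
move=> -> //; last by move=> x y _; apply: injb.
rewrite (eq_bigr (fun=> k.-1)); last first.
  by move=> i _; rewrite (cardC1 i) card_ord.
by rewrite sum_nat_const card_ord -{1}(bin1 k.-1) mul_bin_diag mul2n.
Qed.

Lemma inj_sum_ge b : injective b -> ('C(k, 2) <= \sum_i b i)%N.
Proof.
move=> injb; rewrite -(sum_rank_inj injb); apply: leq_sum => i _.
by apply: (@card_below _ predT) => x y _ _; apply: injb.
Qed.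

(** Each [b i] is at least the number of smaller values of [b]; if the sum is
    minimal these are equalities, and there are fewer than [k] smaller values. *)
Lemma inj_sum_eq b : injective b -> (\sum_i b i = 'C(k, 2))%N ->
  exists p : 'S_k, forall i, b i = p i.
Proof.
move=> injb sb.
have le i : (#|[pred j | b j < b i]| <= b i)%N.
  by apply: (@card_below _ predT) => x y _ _; apply: injb.
have eqr i : #|[pred j | (b j < b i)%N]| = b i.
  apply/eqP; rewrite eqn_leq le /= leqNgt; apply/negP => lti.
  have: (\sum_i #|[pred j | b j < b i]| < \sum_i b i)%N.
    rewrite (bigD1 i) // [X in (_ < X)%N](bigD1 i) //=.
    by rewrite -addSn leq_add // leq_sum.
  by rewrite sum_rank_inj // sb ltnn.
have ltb i : (b i < k)%N.
  rewrite -eqr -[X in (_ < X)%N]card_ord; apply: proper_card.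
  by apply/properP; split; [apply/subsetP | exists i; rewrite ?inE ?ltnn].
have injp : injective (fun i => Ordinal (ltb i)).
  by move=> i j /(congr1 val) /= /injb.
by exists (perm injp) => i; rewrite permE.
Qed.

Lemma rearr_sign_sum_lt b c : (\sum_i b i < 'C(k, 2))%N -> rearr_sign c b = 0.
Proof.
move=> lts; have [/injectiveP injb|] := boolP (injectiveb b).
  by have := inj_sum_ge injb; rewrite leqNgt lts.
by case/injectivePn => i [j nij /alt_eq0_l]; apply.
Qed.

Lemma sum_nat_eqc B d : (\sum_(1 <= m < B.+1) (m == d) = (0 < d <= B))%N.
Proof.
elim: B => [|B IH]; first by rewrite big_geq //; lia.
by rewrite big_nat_recr //= IH; lia.
Qed.

Lemma sum_nat_leq B d : (\sum_(1 <= m < B.+1) (m <= d) = minn d B)%N.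
Proof.
elim: B => [|B IH]; first by rewrite big_geq //; lia.
by rewrite big_nat_recr //= IH; lia.
Qed.

Section Recursion.
Variables (b c : 'I_k -> nat) (S : nat).
Hypotheses (sb : (\sum_i b i = S)%N) (sc : (\sum_i c i = S)%N).

Let agree (i l : 'I_k) (w : 'S_k) :=
  [forall x, (x != i) && (x != l) ==> (c (w x) == b x)].

Let agree_sum i l w : i != l -> agree i l w ->
  (c (w i) + c (w l) = b i + b l)%N.
Proof.
move=> nil /forallP ag.
have scw : (\sum_x c (w x) = \sum_x b x)%N.
  by rewrite sb -sc [RHS](reindex_inj (@perm_inj _ w)).
have D (F : 'I_k -> nat) :
    (\sum_x F x = F i + (F l + \sum_(x | (x != i) && (x != l)) F x))%N.
  by rewrite (bigD1 i) //= (bigD1 l) //= eq_sym.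
rewrite !D in scw.
have E : (\sum_(x | (x != i) && (x != l)) c (w x) =
  \sum_(x | (x != i) && (x != l)) b x)%N.
  by apply: eq_bigr => x nx; apply/eqP/(implyP (ag x)).
by lia.
Qed.

Let agree_sym i l w : agree i l w = agree l i w.
Proof. by apply: eq_forallb => x; rewrite andbC. Qed.

Let agree_eq i l w : i != l ->
  agree i l w && (c (w i) == b i) = [forall x, 0 + c (w x) == b x]%N.
Proof.
move=> nil; apply/andP/forallP => [[ag /eqP ei] x|h].
  have := agree_sum nil ag; rewrite ei => /addnI el.
  case: (eqVneq x i) => [->|nxi]; first by rewrite ei.
  case: (eqVneq x l) => [->|nxl]; first by rewrite el.
  by move/forallP: ag => /(_ x); rewrite nxi nxl.
by split; [apply/forallP => x; apply/implyP => _|]; exact: h.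
Qed.

Let sum_agree0 i l : i != l -> \sum_(w : 'S_k) (-1) ^+ w * (agree i l w)%:R = 0 :> int.
Proof.
move=> nil; apply: int_eq_opp0.
rewrite {1}(reindex_inj (mulgI (tperm i l))) -sumrN /=; apply: eq_bigr => w _.
rewrite odd_permM odd_tperm nil addTb signrN mulNr; congr (- (_ * _%:R)).
congr nat_of_bool; apply: eq_forallb => x; rewrite permM.
by case: tpermP => [->|->|//]; rewrite eqxx ?andbF.
Qed.

(** The recursion on which [alternant_orthogonality] rests.  Expand the
    determinants over w and write [j = w l].  The terms with [l = i] contribute [S]
    times the determinant.  In the terms with [l <> i] the value of m is determined:
    w matches [b] and [c] away from i and l, and [c (w i) < b i].  Composing w with
    the transposition of i and l shows that the signs of all w that match away from
    i and l cancel; as the cases [c (w i) < b i] and [c (w i) > b i] are exchanged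
    by swapping i and l, each of them contributes minus half of what the case of
    equality does, namely ['C(k, 2)] times the determinant with a minus sign. *)
Lemma rearr_sign_lower_sum B : (S <= B)%N ->
  \sum_i \sum_j \sum_(1 <= m < B.+1)
     ((m <= b i) && (m <= c j))%N%:R *
       rearr_sign (fun x => b x - m * (x == i))%N (fun x => c x - m * (x == j))%N
  = (S%:R - 'C(k, 2)%:R) * rearr_sign b c.
Proof.
move=> leSB.
have leb i : (b i <= B)%N by apply: leq_trans leSB; rewrite -sb (bigD1 i) ?leq_addr.
(* The signs of the w that match b with c away from i and l and satisfy R at i. *)
pose U (R : nat -> nat -> bool) : int := \sum_i \sum_(l | l != i) \sum_(w : 'S_k)
  (-1) ^+ w * (agree i l w && R (c (w i)) (b i))%:R.
have UE : U (fun x y => x == y)%N = (k * k.-1)%:R * rearr_sign b c.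
  have inner i : \sum_(l | l != i) \sum_(w : 'S_k)
     (-1) ^+ w * (agree i l w && (c (w i) == b i))%:R = k.-1%:R * rearr_sign b c.
    rewrite (eq_bigr (fun=> rearr_sign b c)) => [|l nli].
      by rewrite sumr_const (cardC1 i) card_ord mulr_natl.
    rewrite /rearr_sign /alt_coef [RHS]big_mkcond; apply: eq_bigr => w _.
    by rewrite agree_eq 1?eq_sym //; case: ifP; rewrite ?mulr1 ?mulr0.
  by rewrite /U (eq_bigr _ (fun i _ => inner i)) sumr_const card_ord -[LHS]mulr_natl natrM mulrA.
have Usym : U (fun x y => x < y)%N = U (fun x y => y < x)%N.
  rewrite /U (exchange_big_dep predT) //=; apply: eq_bigr => i _.
  apply: eq_big => [l|l nli]; first by rewrite eq_sym.
  apply: eq_bigr => w _; congr (_ * (nat_of_bool _)%:R).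
  rewrite agree_sym; case ag: (agree i l w) => //=.
  by have := agree_sum nli ag; lia.
have U0 : U (fun x y => x < y)%N + U (fun x y => y < x)%N + U (fun x y => x == y)%N = 0.
  rewrite /U -!big_split big1 // => i _; rewrite -!big_split big1 // => l nli.
  rewrite -!big_split -[RHS](@sum_agree0 i l) 1?eq_sym //; apply: eq_bigr => w _.
  rewrite /= -!mulrDr -!natrD; congr (_ * _%:R).
  by case: (agree i l w) => //=; case: ltngtP.
have -> : \sum_i \sum_j \sum_(1 <= m < B.+1)
     ((m <= b i) && (m <= c j))%N%:R *
       rearr_sign (fun x => b x - m * (x == i))%N (fun x => c x - m * (x == j))%N
   = S%:R * rearr_sign b c + U (fun x y => x < y)%N.
  have ->: S%:R * rearr_sign b c = \sum_i (b i)%:R * rearr_sign b c by rewrite -mulr_suml -natr_sum sb.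
  rewrite /U -big_split; apply: eq_bigr => i _ /=.
  pose C (w : 'S_k) l m := [&& (m <= b i)%N, (m <= c (w l))%N &
     [forall x, (c (w x) - m * (x == l) == b x - m * (x == i))%N]].
  have -> : \sum_j \sum_(1 <= m < B.+1) ((m <= b i) && (m <= c j))%N%:R *
       rearr_sign (fun x => b x - m * (x == i))%N (fun x => c x - m * (x == j))%N
    = \sum_l \sum_(w : 'S_k) (-1) ^+ w * (\sum_(1 <= m < B.+1) C w l m)%:R.
    under eq_bigr => j _ do under eq_bigr => m _ do rewrite /rearr_sign /alt_coef mulr_sumr big_mkcond /=.
    under eq_bigr => j _ do rewrite exchange_big /=.
    rewrite exchange_big [RHS]exchange_big; apply: eq_bigr => w _ /=.
    rewrite (reindex_inj (@perm_inj _ w)); apply: eq_bigr => l _.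
    rewrite natr_sum mulr_sumr; apply: eq_bigr => m _; rewrite /C.
    under [in LHS]eq_forallb => x do rewrite add0n (inj_eq (@perm_inj _ w)).
    by rewrite andbA; case: [forall _, _]; rewrite ?andbT ?andbF ?mulr0 // mulrC.
  rewrite (bigD1 i) //=; congr (_ + _).
    rewrite /rearr_sign /alt_coef mulr_sumr [RHS]big_mkcond; apply: eq_bigr => w _ /=.
    have -> : (\sum_(1 <= m < B.+1) C w i m =
       [forall x, 0 + c (w x) == b x] * b i)%N.
      rewrite -[X in (_ * X)%N](minn_idPl (leb i)) -sum_nat_leq big_distrr /=.
      apply: eq_bigr => m _; rewrite mulnb; congr nat_of_bool.
      rewrite /C andbA andbC; apply/andP/andP => -[/forallP h].
        case/andP => l1 l2; split=> //; apply/forallP => x; have := h x.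
        by case: (eqVneq x i) => [->|]; rewrite ?muln0 ?subn0 //; lia.
      move=> l1; split; last by have := h i; lia.
      by apply/forallP => x; have := h x; rewrite add0n => /eqP ->.
    by case: ifP => _; rewrite ?mul0n ?mulr0 // mul1n mulrC.
  apply: eq_bigr => l nli; apply: eq_bigr => w _; congr (_ * _%:R).
  case ag: (agree i l w) => /=; last first.
    rewrite big1 // => m _; apply/eqP; rewrite eqb0; apply: contraFN ag.
    case/and3P => _ _ /forallP h; apply/forallP => x; apply/implyP => /andP[n1 n2].
    by have := h x; rewrite (negbTE n1) (negbTE n2) !muln0 !subn0.
  have := agree_sum _ ag; rewrite eq_sym => /(_ nli) es.
  transitivity (\sum_(1 <= m < B.+1) (m == b i - c (w i)))%N; last first.
    by rewrite sum_nat_eqc; have := leb i; lia.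
  apply: eq_big_nat => m /andP[m1 mB]; congr nat_of_bool.
  apply/and3P/eqP => [[h1 h2 /forallP h]|em].
    by have := h i; have := h l; rewrite !eqxx (eq_sym i) (negbTE nli); lia.
  split; try lia; apply/forallP => x.
  case: (eqVneq x l) => [->|nxl]; first by rewrite (negbTE nli); lia.
  case: (eqVneq x i) => [->|nxi]; first by lia.
  by move/forallP: ag => /(_ x); rewrite nxi nxl; lia.
have := mul_bin_diag k 1; rewrite bin1 => kk.
by move: UE U0 Usym; rewrite kk; lia.
Qed.

End Recursion.

End Alternant.

(** * Orthogonality of alternants *)

Definition bump_at (Z : finType) (f : {ffun Z -> nat}) m z : {ffun Z -> nat} :=
  [ffun y => (f y + m * (y == z))%N].

Lemma mass_bump (Z : finType) (f : {ffun Z -> nat}) m z :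
  mass (bump_at f m z) = (mass f + m)%N.
Proof.
rewrite /mass; under eq_bigr => y _ do rewrite ffunE.
rewrite big_split /=; congr (_ + _)%N.
by rewrite (bigD1 z) //= eqxx muln1 big1 ?addn0 // => y /negbTE ->; rewrite muln0.
Qed.

Lemma entry_le_mass (Z : finType) (f : Z -> nat) z : (f z <= mass f)%N.
Proof. by rewrite /mass (bigD1 z) //= leq_addr. Qed.

Lemma array_bump N (Z : finType) n m (z : Z) (G : {ffun Z -> nat} -> int) :
  (n < N)%N -> (0 < m <= n)%N ->
  \sum_(M : {ffun Z -> 'I_N} | (mass (entries M) == n) && (m <= M z)%N) G (entries M)
  = \sum_(M : {ffun Z -> 'I_N} | mass (entries M) == (n - m)%N)
       G (bump_at (entries M) m z).
Proof.
case: N => // N ltn /andP[m0 lemn].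
pose up (M : {ffun Z -> 'I_N.+1}) : {ffun Z -> 'I_N.+1} :=
  [ffun y => inord (bump_at (entries M) m z y)].
pose down (M : {ffun Z -> 'I_N.+1}) : {ffun Z -> 'I_N.+1} :=
  [ffun y => inord (M y - m * (y == z))].
have upE M : mass (entries M) = (n - m)%N -> entries (up M) = bump_at (entries M) m z.
  move=> tM; apply/ffunP => y; rewrite !ffunE inordK //.
  have := entry_le_mass (bump_at (entries M) m z) y.
  by rewrite mass_bump tM subnK // !ffunE => /leq_ltn_trans; apply.
have downE (M : {ffun Z -> 'I_N.+1}) : (m <= M z)%N ->
    bump_at (entries (down M)) m z = entries M.
  move=> lemM; apply/ffunP => y; rewrite !ffunE inordK; last first.
    by rewrite ltnS (leq_trans (leq_subr _ _)) // -ltnS.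
  by case: eqVneq => [->|]; lia.
have downK (M : {ffun Z -> 'I_N.+1}) : (m <= M z)%N -> up (down M) = M.
  move=> lemM; apply/ffunP => y; rewrite ffunE downE // ffunE.
  exact: inord_val.
have key (M : {ffun Z -> 'I_N.+1}) :
    [&& mass (entries (up M)) == n, (m <= up M z)%N & down (up M) == M]
    = (mass (entries M) == (n - m)%N).
  apply/and3P/eqP => [[/eqP tU leU /eqP dU]|tM].
    by rewrite -{1}dU; have := mass_bump (entries (down (up M))) m z; rewrite downE // tU; lia.
  have eU y : up M y = (M y + m * (y == z))%N :> nat.
    by have /ffunP/(_ y) := upE _ tM; rewrite !ffunE.
  split; first by rewrite upE // mass_bump tM subnK.
    by rewrite eU eqxx muln1 leq_addl.
  by apply/eqP/ffunP => y; apply: val_inj; rewrite ffunE eU addnK inord_val.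
rewrite (reindex_onto up down); last by move=> M /andP[_]; apply: downK.
apply: eq_big => [M|M]; first by rewrite -andbA key.
by rewrite -andbA key => /eqP /upE ->.
Qed.

(** The sum of the entries of an array M counts the pairs of a place z and a
    number m with [0 < m <= M z], and such a pair amounts to the array obtained by
    subtracting m at z. *)
Lemma array_recursion N (Z : finType) n (G : {ffun Z -> nat} -> int) :
  (n < N)%N ->
  n%:R * (\sum_(M : {ffun Z -> 'I_N} | mass (entries M) == n) G (entries M))
  = \sum_z \sum_(1 <= m < n.+1)
     \sum_(M : {ffun Z -> 'I_N} | mass (entries M) == (n - m)%N)
       G (bump_at (entries M) m z).
Proof.
move=> ltnN; transitivity (\sum_z \sum_(1 <= m < n.+1)
   \sum_(M : {ffun Z -> 'I_N} | (mass (entries M) == n) && (m <= M z)%N) G (entries M)).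
  under [RHS]eq_bigr => z _ do under eq_bigr => m _ do rewrite big_mkcondr.
  under [RHS]eq_bigr => z _ do rewrite exchange_big /=.
  rewrite [RHS]exchange_big mulr_sumr; apply: eq_bigr => M /eqP tM /=.
  have lez z : (M z <= n)%N by have := entry_le_mass (entries M) z; rewrite tM ffunE.
  under eq_bigr => z _ do
    (under eq_bigr => m _ do rewrite -[G _]mulr1n -mulrb -mulr_natl;
     rewrite -mulr_suml -natr_sum sum_nat_leq (minn_idPl (lez z))).
  rewrite -mulr_suml -natr_sum -{1}tM; congr (_%:R * _).
  by apply: eq_bigr => z _; rewrite ffunE.
apply: eq_bigr => z _; apply: eq_big_nat => m mb.
exact: array_bump.
Qed.

Definition row_sum (I J : finType) (m : {ffun I * J -> nat}) (i : I) : nat := (\sum_j m (i, j))%N.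
Definition col_sum (I J : finType) (m : {ffun I * J -> nat}) (j : J) : nat := (\sum_i m (i, j))%N.

Lemma row_bump (I J : finType) (f : {ffun I * J -> nat}) m i j x :
  row_sum (bump_at f m (i, j)) x = (row_sum f x + m * (x == i))%N.
Proof.
rewrite /row_sum; under eq_bigr => y _ do rewrite ffunE xpair_eqE.
rewrite big_split /=; congr (_ + _)%N.
rewrite (bigD1 j) //= eqxx andbT big1 ?addn0 // => y /negbTE ->.
by rewrite andbF muln0.
Qed.

Lemma col_bump (I J : finType) (f : {ffun I * J -> nat}) m i j x :
  col_sum (bump_at f m (i, j)) x = (col_sum f x + m * (x == j))%N.
Proof.
rewrite /col_sum; under eq_bigr => y _ do rewrite ffunE xpair_eqE.
rewrite big_split /=; congr (_ + _)%N.
rewrite (bigD1 i) //= eqxx big1 ?addn0 // => y /negbTE ->.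
by rewrite muln0.
Qed.

Section Orthogonality.
Variable k : nat.
Implicit Types b c : 'I_k -> nat.

Lemma alt_shift a b (x y : 'I_k -> nat) :
  alt_coef a b (fun i => x i + y i)%N
  = [forall i, y i <= b i]%N%:R * alt_coef a (fun i => b i - y i)%N x.
Proof.
case: forallP => [le|nle]; rewrite ?mul1r ?mul0r.
  by apply: eq_bigl => w; apply: eq_forallb => i; have := le i; lia.
rewrite /alt_coef big_pred0 // => w; apply/negP => /forallP h.
by apply: nle => i; have := h i; lia.
Qed.

Lemma sum_sub_delta b m i : (m <= b i)%N ->
  (\sum_x (b x - m * (x == i)) = \sum_x b x - m)%N.
Proof.
move=> lem; rewrite (bigD1 i) //= [in RHS](bigD1 i) //= eqxx muln1.
rewrite (eq_bigr b) ?addnBAC // => x /negbTE ->; lia.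
Qed.

(** The only term of the orthogonality relation for the zero matrix.  If [c] is
    injective, the minimality of its sum makes it a permutation. *)
Lemma alternant_rearr_sign b c : (\sum_i c i = 'C(k, 2))%N ->
  alt_coef delta b (fun=> 0%N) * alt_coef delta c (fun=> 0%N) = rearr_sign b c.
Proof.
move=> sc; have [/injectiveP injc|] := boolP (injectiveb c); last first.
  case/injectivePn => i [j nij ec].
  by rewrite (alt_eq0_r _ nij ec) // mulr0 /rearr_sign (alt_eq0_l _ _ nij ec).
have [p ep] := inj_sum_eq injc sc.
have -> : alt_coef delta c (fun=> 0%N) = (-1) ^+ p.
  rewrite /alt_coef (big_pred1 p) // => w /=; apply/forallP/eqP => [h|-> i].
    by apply/permP => i; apply: val_inj; rewrite /= -ep; apply/eqP/h.
  by rewrite ep.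
rewrite /rearr_sign /alt_coef mulr_suml [LHS](reindex_inj (mulIg p)) /=.
apply: eq_big => [w|w _].
  by apply: eq_forallb => i; rewrite permM ep.
by rewrite odd_permM signr_addb -mulrA -expr2 sqrr_sign mulr1.
Qed.

(** Comparing coefficients in Cauchy's identity, which says that the product of
    the Vandermonde alternants in x and in y divided by the product of the
    1 - x_i y_j is the determinant of the matrix of the 1 / (1 - x_i y_j), gives
    this formula.  It is proved here by induction on [n]: both sides multiplied by
    [n] satisfy the same recursion. *)
Lemma alternant_orthogonality N n b c : (n < N)%N ->
  (\sum_i b i = n + 'C(k, 2))%N -> (\sum_i c i = n + 'C(k, 2))%N ->
  \sum_(M : {ffun 'I_k * 'I_k -> 'I_N} | mass (entries M) == n)
     alt_coef delta b (row_sum (entries M)) * alt_coef delta c (col_sum (entries M))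
  = rearr_sign b c.
Proof.
elim/ltn_ind: n b c => -[|n] IH b c ltN sb sc.
  rewrite -alternant_rearr_sign //.
  rewrite (big_pred1 [ffun=> Ordinal ltN]) => [|M].
    by congr (_ * _); apply: eq_alt_coef => // i; rewrite /row_sum /col_sum big1 // => j _; rewrite !ffunE.
  rewrite /mass sum_nat_eq0 /=; apply/forallP/eqP => [h|-> z]; last by rewrite !ffunE.
  by apply/ffunP => z; apply: val_inj; rewrite ffunE /=; have /eqP := h z; rewrite ffunE.
pose S := (n.+1 + 'C(k, 2))%N.
apply: (@mulfI _ n.+1%:R); first by rewrite pnatr_eq0.
have /= -> := @array_recursion _ _ _ (fun f => alt_coef delta b (row_sum f) * alt_coef delta c (col_sum f)) ltN.
have := rearr_sign_lower_sum sb sc (leqnn _).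
rewrite -/S -natrB ?leq_addl // addnK => <-.
rewrite (eq_bigr (fun z => \sum_(1 <= m < S.+1)
   ((m <= b z.1) && (m <= c z.2))%N%:R *
   rearr_sign (fun x => b x - m * (x == z.1))%N (fun x => c x - m * (x == z.2))%N)).
  by rewrite pair_bigA.
case=> i j _ /=.
rewrite (@big_cat_nat _ _ _ n.+2 1 S.+1) //=; last by rewrite /S; lia.
(* For m > n + 1 the sum of the lowered c is below that of 0, ..., k - 1. *)
rewrite [X in _ = _ + X]big1_seq ?addr0; last first.
  move=> m /andP[_]; rewrite mem_index_iota => mb.
  case: andP => [[lb lc]|_]; last by rewrite mul0r.
  rewrite mul1r rearr_sign_sum_lt // sum_sub_delta // sc; lia.
apply: eq_big_nat => m mb.
transitivity (((m <= b i) && (m <= c j))%N%:R *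
 \sum_(M : {ffun 'I_k * 'I_k -> 'I_N} | mass (entries M) == (n.+1 - m)%N)
   alt_coef delta (fun x => b x - m * (x == i))%N (row_sum (entries M)) *
   alt_coef delta (fun x => c x - m * (x == j))%N (col_sum (entries M))).
  rewrite mulr_sumr; apply: eq_bigr => M _.
  rewrite (eq_alt_coef (frefl _) (frefl _) (fun x => row_bump _ _ _ _ x)).
  rewrite [alt_coef _ c _](eq_alt_coef (frefl _) (frefl _) (fun x => col_bump _ _ _ _ x)).
  rewrite !alt_shift.
  have E a (l : 'I_k) : [forall x, m * (x == l) <= a x]%N = (m <= a l)%N.
    apply/forallP/idP => [/(_ l)|h x]; first by rewrite eqxx muln1.
    by case: eqVneq => [->|]; rewrite ?muln1 ?muln0.
  by rewrite !E; do 2!case: (_ <= _)%N; rewrite ?mul1r ?mul0r ?mulr0.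
case: andP => [[lb lc]|_]; last by rewrite !mul0r.
rewrite !mul1r IH //; try lia.
  by rewrite sum_sub_delta // sb; lia.
by rewrite sum_sub_delta // sc; lia.
Qed.

End Orthogonality.

(** * Left multiplication in a group algebra *)

Lemma mxtrace_square0 (F : fieldType) n (P : 'M[F]_n) : P *m P = 0 -> \tr P = 0.
Proof.
have [D DC] := row_fullP (col_base_full P).
have [E RE] := row_freeP (row_base_free P).
move=> P0; have RC0 : row_base P *m col_base P = 0.
  rewrite -[LHS]mul1mx -DC -[LHS]mulmx1 -RE.
  have -> : D *m col_base P *m (row_base P *m col_base P) *m (row_base P *m E)
    = D *m ((col_base P *m row_base P) *m (col_base P *m row_base P)) *m E.
    by rewrite !mulmxA.
  by rewrite mulmx_base P0 mulmx0 mul0mx.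
by rewrite -(mulmx_base P) mxtrace_mulC RC0 mxtrace0.
Qed.

(** Up to the factor [kappa], P is a projector onto U, so the trace on U is the
    trace of the projector followed by the action. *)
Lemma mxtrace_submod (F : fieldType) (gT : finGroupType) (G : {group gT}) n
    (rG : mx_representation F G n) (U P : 'M[F]_n) (modU : mxmodule rG U)
    (kappa : F) (g : gT) :
  (P :=: U)%MS -> P *m P = kappa *: P -> kappa != 0 -> g \in G ->
  \tr (submod_repr modU g) = kappa^-1 * \tr (P *m rG g).
Proof.
move=> ePU PP k0 Gg; set Y := submod_repr modU g.
pose B : 'M_(\rank U, n) := val_submod 1%:M.
have YB : Y *m B = B *m rG g.
  rewrite -val_submodE in_submodK //.
  by rewrite (submx_trans (submxMr _ (val_submodP _))) // (mxmoduleP modU).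
have /submxP[X eX] : (B <= P)%MS by rewrite ePU val_submodP.
have /submxP[Q eQ] : (P <= B)%MS by rewrite ePU val_submod1.
have BQ : B *m Q = kappa%:M.
  apply: (can_inj (@val_submodK _ _ U _)).
  rewrite [LHS]val_submodE [RHS]val_submodE -/B -mulmxA -eQ {1}eX -mulmxA PP -scalemxAr -eX.
  by rewrite mul_scalar_mx.
have -> : \tr (P *m rG g) = \tr (Y *m (B *m Q)).
  by rewrite eQ -mulmxA -YB mxtrace_mulC -mulmxA.
by rewrite BQ mul_mx_scalar linearZ /= mulKf.
Qed.

Section LeftMult.

Variables (F : fieldType) (gT : finGroupType).
Local Notation G := [set: gT]%G.
Local Notation aG := (regular_repr F G).

Definition group_sum (y : gT -> F) : 'M[F]_#|G| := \sum_(g : gT) y g *: aG g.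

(** The matrix, in the basis of group elements, of left multiplication by
    [group_sum y]; it commutes with the right regular representation. *)
Definition left_mult (y : gT -> F) : 'M[F]_#|G| :=
  \matrix_(i, j) y (enum_val j * (enum_val i)^-1)%g.

Lemma regular_reprE (g : gT) (i j : 'I_#|G|) :
  aG g i j = (enum_val j == enum_val i * g)%g%:R.
Proof.
rewrite /= /regular_mx mxE mxE eqxx /= eq_sym.
by rewrite -(inj_eq enum_val_inj) gring_indexK ?inE // eq_sym.
Qed.

Lemma gring_row_sum y (j : 'I_#|G|) : gring_row (group_sum y) 0 j = y (enum_val j).
Proof.
rewrite /gring_row mxE summxE (bigD1 (enum_val j)) //= mxE regular_reprE.
rewrite gring_indexK ?inE // mul1g eqxx mulr1 big1 ?addr0 // => g ng.
by rewrite mxE regular_reprE gring_indexK ?inE // mul1g eq_sym (negbTE ng) mulr0.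
Qed.

Lemma row_left_mult y i :
  row i (left_mult y) = gring_row (group_sum y) *m aG (enum_val i).
Proof.
apply/rowP => j; rewrite !mxE.
have Gi : (enum_val j * (enum_val i)^-1)%g \in G by rewrite inE.
rewrite (bigD1 (gring_index G (enum_val j * (enum_val i)^-1)%g)) //=.
rewrite gring_row_sum regular_reprE gring_indexK // mulgKV eqxx mulr1.
rewrite big1 ?addr0 // => l nl; rewrite regular_reprE.
case: eqP => [e|_]; last by rewrite mulr0.
case/eqP: nl; rewrite e mulgK; exact/esym/gring_valK.
Qed.

Lemma left_mult_cyclic y :
  (left_mult y :=: cyclic_mx aG (gring_row (group_sum y)))%MS.
Proof.
apply/eqmxP/andP; split.
  apply/row_subP => i; rewrite row_left_mult; apply/cyclic_mxP.
  by exists (aG (enum_val i)) => //; rewrite envelop_mx_id ?inE.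
apply: cyclic_mx_sub.
  apply/mxmoduleP => g _; apply/row_subP => i.
  rewrite row_mul row_left_mult -mulmxA -repr_mxM ?inE //.
  have := row_left_mult y (gring_index G (enum_val i * g)%g).
  by rewrite gring_indexK ?inE // => <-; apply: row_sub.
have := row_left_mult y (gring_index G 1%g).
by rewrite gring_indexK ?inE // repr_mx1 mulmx1 => <-; apply: row_sub.
Qed.

Lemma left_mult_comp y z :
  left_mult y *m left_mult z
  = left_mult (fun g => \sum_h z h * y (h^-1 * g)%g).
Proof.
apply/matrixP => i j; rewrite !mxE.
rewrite (reindex_onto (gring_index G) (@enum_val _ (mem G))) /=; last first.
  by move=> l _; apply: gring_valK.
rewrite (reindex_inj (mulIg (enum_val j))) /= (reindex_inj (@invg_inj _)) /=.
apply: eq_big => [h|h _]; first by rewrite gring_indexK ?inE ?eqxx.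
rewrite !mxE gring_indexK ?inE // mulrC invMg invgK.
by rewrite mulgA mulgV mul1g mulgA.
Qed.

Lemma trace_left_mult y g :
  \tr (left_mult y *m aG g) = \sum_h y (h * g^-1 * h^-1)%g.
Proof.
rewrite /mxtrace (reindex_onto (gring_index G) (@enum_val _ (mem G))) /=; last first.
  by move=> l _; apply: gring_valK.
apply: eq_big => [h|h _]; first by rewrite gring_indexK ?inE ?eqxx.
rewrite mxE (bigD1 (gring_index G (h * g^-1)%g)) //= regular_reprE.
rewrite !gring_indexK ?inE // mulgKV eqxx mulr1 mxE !gring_indexK ?inE //.
rewrite big1 ?addr0 // => l nl; rewrite regular_reprE.
case: eqP => [e|_]; last by rewrite mulr0.
by case/eqP: nl; rewrite gring_indexK ?inE // in e; rewrite e mulgK; exact/esym/gring_valK.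
Qed.

End LeftMult.

(** * Young symmetrizers *)

Section YoungCombinatorics.

Variables (n : nat) (la : seq nat).
Hypotheses (la_sorted : sorted geq la) (la_size : sumn la = n).

Local Notation row_ := (reshape_index la).
Local Notation col_ := (reshape_offset la).
Local Notation part r := (nth 0%N la r).

Lemma part_anti r s : (r <= s)%N -> (part s <= part r)%N.
Proof.
move=> lers; case: (ltnP s (size la)) => [lts|]; last by move/(nth_default 0%N) ->.
have tr : transitive geq by move=> a b c /= ab bc; apply: leq_trans bc ab.
have rf : reflexive geq by move=> a /=.
by apply: (sorted_leq_nth tr rf 0%N la_sorted) => //; rewrite inE (leq_ltn_trans lers).
Qed.

Lemma col_lt (i : 'I_n) : (col_ i < part (row_ i))%N.
Proof. by apply: reshape_offsetP; rewrite la_size. Qed.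

Lemma cell_inj (i j : 'I_n) : row_ i = row_ j -> col_ i = col_ j -> i = j.
Proof.
move=> er ec; apply: val_inj; rewrite /= -(reshape_indexK la i) er ec.
exact: reshape_indexK.
Qed.

Lemma cell_exists r c : (c < part r)%N ->
  exists i : 'I_n, row_ i = r /\ col_ i = c.
Proof.
move=> ltc; have lti := flatten_indexP ltc; rewrite la_size in lti.
exists (Ordinal lti) => /=.
by rewrite flatten_indexKl // flatten_indexKr.
Qed.

Lemma same_col_sym : symmetric (fun x y : 'I_n => same_col la x y).
Proof. by move=> x y; rewrite /same_col eq_sym. Qed.

(** The cells above a cell in its column occupy all the preceding rows. *)
Lemma sum_row_le_rank :
  (\sum_(x : 'I_n) row_ x
   <= \sum_(x : 'I_n) #|[pred y : 'I_n | same_col la x y && (row_ y < row_ x)]|)%N.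
Proof.
apply: leq_sum => x _.
have ex (r : 'I_(row_ x)) : exists i : 'I_n, (row_ i == r) && (col_ i == col_ x).
  have [|i [e1 e2]] := @cell_exists r (col_ x); last by exists i; rewrite e1 e2 !eqxx.
  by apply: leq_trans (col_lt x) (part_anti (ltnW (ltn_ord r))).
pose f r := xchoose (ex r).
have fP r : row_ (f r) = r /\ col_ (f r) = col_ x.
  by have /andP[/eqP ? /eqP ?] := xchooseP (ex r).
have injf : injective f.
  by move=> r s e; apply: val_inj; rewrite /= -(proj1 (fP r)) e (proj1 (fP s)).
rewrite -[X in (X <= _)%N](card_ord (row_ x)) -(card_codom injf).
apply/subset_leq_card/subsetP => _ /codomP[r ->].
by rewrite inE /same_col; have [-> ->] := fP r; rewrite eqxx /=.
Qed.

Definition col_injective (h : 'I_n -> nat) :=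
  forall i j : 'I_n, same_col la i j -> h i = h j -> i = j.

Lemma row_col_injective : col_injective (fun i => row_ i).
Proof. by move=> i j /eqP ec er; apply: cell_inj. Qed.

(** In a column, distinct natural numbers are at least their ranks, and the ranks
    add up to the same total for every function injective on columns. *)
Lemma col_injective_sum h : col_injective h ->
  (\sum_(x : 'I_n) row_ x <= \sum_x h x)%N.
Proof.
move=> injh; apply: leq_trans sum_row_le_rank _.
have := sum_rank same_col_sym row_col_injective.
rewrite -(sum_rank same_col_sym injh) => /double_inj ->.
apply: leq_sum => x _; apply: card_below => y z Py Pz.
by apply: injh; move: Py Pz; rewrite !unfold_in /same_col => /eqP <- /eqP <-.
Qed.

(** Equality in [col_injective_sum] forces the values of [h] on a column to be
    0, 1, ..., one for each cell of the column. *)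
Lemma col_injective_eq h : col_injective h ->
  (\sum_x h x = \sum_(x : 'I_n) row_ x)%N ->
  exists2 q : 'S_n, q \in col_stab n la & forall x, row_ (q x) = h x.
Proof.
move=> injh sumh.
have le (x : 'I_n) : (#|[pred y : 'I_n | same_col la x y && (h y < h x)]| <= h x)%N.
  apply: card_below => y z Py Pz.
  by apply: injh; move: Py Pz; rewrite !unfold_in /same_col => /eqP <- /eqP <-.
have rank (x : 'I_n) : #|[pred y : 'I_n | same_col la x y && (h y < h x)%N]| = h x.
  apply/eqP; rewrite eqn_leq le /= leqNgt; apply/negP => ltx.
  have := sum_row_le_rank; have := sum_rank same_col_sym row_col_injective.
  rewrite -(sum_rank same_col_sym injh) => /double_inj ->.
  rewrite -sumh leqNgt => /negP; apply.
  by rewrite (bigD1 x) //= [X in (_ < X)%N](bigD1 x) //= -addSn leq_add // leq_sum.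
have ltx (x : 'I_n) : (h x < #|[pred y : 'I_n | same_col la x y]|)%N.
  rewrite -{1}rank; apply: proper_card; apply/properP; split.
    by apply/subsetP => y; rewrite !inE => /andP[].
  by exists x; rewrite !inE ?ltnn ?andbF // /same_col.
have ex (x : 'I_n) : exists i : 'I_n, (row_ i == h x) && (col_ i == col_ x).
  have [y /andP[/eqP ecy ley]] : exists y : 'I_n, same_col la x y && (h x <= row_ y)%N.
    apply/existsP; apply: contraLR (ltx x); rewrite negb_exists -leqNgt => /forallP no.
    have injr : {in [pred y : 'I_n | same_col la x y] &, injective (fun y : 'I_n => row_ y)}.
      move=> y z; rewrite !inE /same_col => /eqP ey /eqP ez er.
      by apply: cell_inj; rewrite // -ey -ez.
    apply: leq_trans (card_below (h x) injr); apply: eq_leq; apply: eq_card => y.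
    rewrite !inE; case Q: (same_col la x y) => //=.
    by have := no y; rewrite Q /= -ltnNge => ->.
  have [|i [e1 e2]] := @cell_exists (h x) (col_ x); last by exists i; rewrite e1 e2 !eqxx.
  by rewrite ecy; apply: leq_trans (col_lt y) (part_anti ley).
pose f x := xchoose (ex x).
have fP x : row_ (f x) = h x /\ col_ (f x) = col_ x.
  by have /andP[/eqP ? /eqP ?] := xchooseP (ex x).
have injf : injective f.
  move=> x y e; apply: injh; first by rewrite /same_col -(proj2 (fP x)) e (proj2 (fP y)).
  by rewrite -(proj1 (fP x)) e (proj1 (fP y)).
exists (perm injf); last by move=> x; rewrite permE (proj1 (fP x)).
by rewrite inE; apply/forallP => x; rewrite /same_col permE (proj2 (fP x)).
Qed.

Local Notation R := (row_stab n la).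
Local Notation C := (col_stab n la).

Lemma row_stabP (s : 'S_n) : reflect (forall x, row_ (s x) = row_ x) (s \in R).
Proof. by rewrite inE; apply: (iffP forallP) => h x; apply/eqP/h. Qed.

Lemma col_stabP (s : 'S_n) : reflect (forall x, col_ (s x) = col_ x) (s \in C).
Proof. by rewrite inE; apply: (iffP forallP) => h x; apply/eqP/h. Qed.

Lemma row_stabM p s : p \in R -> ((p * s)%g \in R) = (s \in R).
Proof.
move/row_stabP => hp; apply/row_stabP/row_stabP => hs x; last by rewrite permM hs hp.
by have := hs (p^-1 x)%g; rewrite permM permKV => ->; rewrite -hp permKV.
Qed.

Lemma col_stabM p s : p \in C -> ((s * p)%g \in C) = (s \in C).
Proof.
move/col_stabP => hp; apply/col_stabP/col_stabP => hs x; last by rewrite permM hp hs.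
by have := hs x; rewrite permM hp.
Qed.

Lemma row_stabV p : (p^-1 \in R)%g = (p \in R).
Proof.
by apply/row_stabP/row_stabP => h x; [have := h (p x); rewrite permK | have := h (p^-1 x)%g; rewrite permKV].
Qed.

Lemma col_stabV p : (p^-1 \in C)%g = (p \in C).
Proof.
by apply/col_stabP/col_stabP => h x; [have := h (p x); rewrite permK | have := h (p^-1 x)%g; rewrite permKV].
Qed.

Lemma tperm_col_stab (i j : 'I_n) : same_col la i j -> tperm i j \in C.
Proof. by move/eqP => e; apply/col_stabP => x; case: tpermP => [->|->|]. Qed.

Lemma tperm_row_stab (i j : 'I_n) : same_row la i j -> tperm i j \in R.
Proof. by move/eqP => e; apply/row_stabP => x; case: tpermP => [->|->|]. Qed.

Lemma row_col_stab1 s : s \in R -> s \in C -> s = 1%g.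
Proof.
move=> /row_stabP hr /col_stabP hc; apply/permP => x; rewrite perm1.
exact: cell_inj.
Qed.

(** Von Neumann's lemma on Young symmetrizers: if g is not a product of a row
    permutation and a column permutation, it conjugates a transposition inside a
    column into one inside a row. *)
Lemma row_col_dichotomy (g : 'S_n) :
  (exists p q, [/\ p \in R, q \in C & g = (p * q)%g]) \/
  (exists i j : 'I_n, [/\ i != j, same_col la i j & same_row la (g^-1 i)%g (g^-1 j)%g]).
Proof.
pose h (x : 'I_n) : nat := row_ (g^-1 x)%g.
have [/existsP[i /existsP[j /and3P[nij cij rij]]]|no] :=
  boolP [exists i : 'I_n, exists j : 'I_n, [&& i != j, same_col la i j & h i == h j]].
  by right; exists i, j.
left; have injh : col_injective h.
  move=> i j cij hij; apply/eqP; apply: contraNT no => nij.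
  by apply/existsP; exists i; apply/existsP; exists j; rewrite nij cij hij eqxx.
have [|q qC qh] := col_injective_eq injh.
  by rewrite /h [RHS](reindex_inj (@perm_inj _ g^-1%g)).
exists (g * q)%g, (q^-1)%g; rewrite mulgK col_stabV; split=> //.
by apply/row_stabP => x; rewrite permM qh /h permK.
Qed.

Definition ysym (g : 'S_n) : algC :=
  \sum_(p in R) \sum_(q in C | (p * q)%g == g) (-1) ^+ odd_perm q.

Definition young_equivariant (y : 'S_n -> algC) :=
  (forall p g, p \in R -> y (p * g)%g = y g) /\
  (forall q g, q \in C -> y (g * q)%g = (-1) ^+ odd_perm q * y g).

Lemma ysym_equivariant : young_equivariant ysym.
Proof.
split=> [p g Rp|q g Cq].
  rewrite /ysym (reindex_inj (mulgI p)); apply: eq_big => [s|s _].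
    exact: row_stabM.
  by apply: eq_bigl => q; rewrite -mulgA (inj_eq (mulgI p)).
rewrite /ysym mulr_sumr; apply: eq_bigr => p _.
rewrite (reindex_inj (mulIg q)) mulr_sumr; apply: eq_big => [s|s _].
  by rewrite col_stabM // mulgA (inj_eq (mulIg q)).
by rewrite odd_permM signr_addb mulrC.
Qed.

Lemma ysym1 : ysym 1 = 1.
Proof.
have R1 : 1%g \in R by apply/row_stabP => x; rewrite perm1.
have C1 : 1%g \in C by apply/col_stabP => x; rewrite perm1.
have E p q : p \in R -> q \in C -> (p * q)%g = 1%g -> q = 1%g.
  move=> Rp Cq e; apply: row_col_stab1 => //.
  by rewrite -row_stabV (_ : q^-1 = p)%g //; apply/eqP; rewrite eq_sym eq_mulgV1 invgK e.
rewrite /ysym (bigD1 1%g) //= (bigD1 1%g) /=; last by rewrite C1 mulg1 eqxx.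
rewrite odd_perm1 big1 ?addr0; last first.
  by move=> q /andP[/andP[Cq /eqP e] nq]; rewrite (E _ _ R1 Cq e) eqxx in nq.
rewrite big1 ?addr0 // => p /andP[Rp np]; rewrite big1 // => q /andP[Cq /eqP e].
by have e1 := E _ _ Rp Cq e; rewrite e1 mulg1 in e; rewrite e eqxx in np.
Qed.

(** By [row_col_dichotomy] an equivariant function is determined by its value at 1
    on products of row and column permutations, and elsewhere two transpositions
    give it two opposite values, hence the value 0. *)
Lemma young_equivariant_eq y : young_equivariant y ->
  forall g, y g = y 1%g * ysym g.
Proof.
move=> [yl yr] g; have [cl cr] := ysym_equivariant.
have [[p [q [Rp Cq ->]]]|[i [j [nij cij rij]]]] := row_col_dichotomy g.
  rewrite yl // cl // -[q]mul1g yr // cr // ysym1 mulr1; exact: mulrC.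
pose t := tperm i j.
have tg : (tperm (g^-1 i) (g^-1 j) * g = g * t)%g.
  by rewrite /t -tpermJ conjgE invgK !mulgA mulgKV.
have V z : young_equivariant z -> z g = 0.
  move=> [zl zr]; have: z g = - z g.
    rewrite -{1}(zl _ g (tperm_row_stab rij)) tg zr ?tperm_col_stab //.
    by rewrite odd_tperm nij expr1 mulN1r.
  move/eqP; rewrite -addr_eq0 -mulr2n -mulr_natl mulf_eq0 pnatr_eq0 /=.
  by move/eqP.
by rewrite !V ?mulr0 //; split.
Qed.

(** The scalar such that the Young symmetrizer divided by it is idempotent. *)
Definition kappa : algC := \sum_g ysym g * ysym (g^-1)%g.

Lemma ysym_conv x : \sum_g ysym g * ysym (g^-1 * x)%g = kappa * ysym x.
Proof.
have [cl cr] := ysym_equivariant.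
rewrite (@young_equivariant_eq (fun x => \sum_g ysym g * ysym (g^-1 * x)%g)).
  by congr (_ * _); apply: eq_bigr => g _; rewrite mulg1.
split=> [p z Rp|q z Cq].
  rewrite (reindex_inj (mulgI p)) /=; apply: eq_bigr => g _.
  by rewrite cl // invMg -!mulgA mulKg.
by rewrite mulr_sumr; apply: eq_bigr => g _; rewrite mulgA cr // mulrCA.
Qed.

(** For fixed g, the inner sum with the last factor g replaced by a variable x is
    an equivariant function of x, hence proportional to the Young symmetrizer.
    With [y] the symmetrizer this yields the norm of the Specht character, with [y]
    the indicator of the row stabilizer its product with a permutation character. *)
Lemma ysym_conj_sum (y : 'S_n -> algC) :
  (forall p g, p \in R -> y (p * g)%g = y g) ->
  \sum_g \sum_h y h * ysym (g^-1 * h^-1 * g)%g = kappa * \sum_h y h * ysym h^-1%g.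
Proof.
move=> yl; have [cl cr] := ysym_equivariant.
pose Y g x := \sum_h y h * ysym (g^-1 * h^-1 * x)%g.
transitivity (\sum_g Y g 1%g * ysym g).
  apply: eq_bigr => g _; rewrite -/(Y g g); apply: young_equivariant_eq.
  split=> [p z Rp|q z Cq]; rewrite /Y.
    rewrite (reindex_inj (mulgI p)) /=; apply: eq_bigr => h _.
    by rewrite yl // invMg -!mulgA mulKg.
  by rewrite mulr_sumr; apply: eq_bigr => h _; rewrite mulgA cr // mulrCA.
rewrite /Y; under eq_bigr => g _ do rewrite mulr_suml.
rewrite exchange_big mulr_sumr; apply: eq_bigr => h _ /=.
rewrite mulrCA -ysym_conv mulr_sumr; apply: eq_bigr => g _.
by rewrite mulg1 -mulrA; congr (_ * _); apply: mulrC.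
Qed.

Lemma young_symmetrizerE : young_symmetrizer n la = group_sum ysym.
Proof.
rewrite /young_symmetrizer /group_sum mulmx_suml.
under [RHS]eq_bigr => g _ do rewrite /ysym scaler_suml.
rewrite exchange_big /=; apply: eq_bigr => p _.
rewrite mulmx_sumr.
under [RHS]eq_bigr => g _ do rewrite scaler_suml.
rewrite (exchange_big_dep (fun q => q \in C)) /=; last by move=> g q _ /andP[].
apply: eq_bigr => q Cq; rewrite (big_pred1 (p * q)%g); last first.
  by move=> g /=; rewrite Cq eq_sym.
by rewrite -scalemxAr repr_mxM ?inE.
Qed.

Lemma left_mult_ysym : left_mult ysym *m left_mult ysym = kappa *: left_mult ysym.
Proof.
rewrite left_mult_comp; apply/matrixP => i j; rewrite !mxE.
exact: ysym_conv.
Qed.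

Lemma trace_ysym : \tr (left_mult ysym) = n`!%:R.
Proof.
have := trace_left_mult ysym 1%g; rewrite repr_mx1 mulmx1 => ->.
rewrite (eq_bigr (fun=> 1)); last by move=> h _; rewrite invg1 mulg1 mulgV ysym1.
by rewrite sumr_const card_Sn.
Qed.

(** Otherwise left multiplication by the symmetrizer would have square zero and
    trace zero, whereas its trace is [n`!]: the symmetrizer has coefficient 1 at the
    identity. *)
Lemma kappa_neq0 : kappa != 0.
Proof.
apply/eqP => k0; have := left_mult_ysym; rewrite k0 scale0r => /mxtrace_square0.
by rewrite trace_ysym => /eqP; rewrite pnatr_eq0 eqn0Ngt fact_gt0.
Qed.

Lemma specht_charE (s : 'S_n) :
  specht_char n la s = kappa^-1 * \sum_g ysym (g * s^-1 * g^-1)%g.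
Proof.
rewrite /specht_char cfunE inE mulr1n.
rewrite (mxtrace_submod (specht_mx_module n la) _ left_mult_ysym kappa_neq0) ?inE //.
  by rewrite trace_left_mult.
by rewrite /specht_mx young_symmetrizerE; apply: left_mult_cyclic.
Qed.

(** The inner product of a class function with the Specht character is, up to
    [kappa], the value of the class function at the Young symmetrizer. *)
Lemma specht_sum (phi : 'S_n -> algC) : (forall s g, phi (s ^ g)%g = phi s) ->
  \sum_s specht_char n la s * phi s^-1%g
  = n`!%:R * (kappa^-1 * \sum_h ysym h * phi h).
Proof.
move=> phiJ; under eq_bigr => s _ do rewrite specht_charE -mulrA mulr_suml.
rewrite -mulr_sumr exchange_big mulrCA /=; congr (_ * _).
rewrite (eq_bigr (fun=> \sum_h ysym h * phi h)).
  by rewrite sumr_const card_Sn mulr_natl.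
move=> g _; rewrite (reindex_inj (@invg_inj _)) /= (reindex_inj (@conjg_inj _ g)) /=.
apply: eq_bigr => s _; rewrite invgK phiJ.
by congr (ysym _ * _); rewrite conjgE !mulgA mulgV mul1g mulgK.
Qed.

Lemma specht_norm : \sum_s specht_char n la s * specht_char n la s^-1%g = n`!%:R.
Proof.
rewrite specht_sum; last by move=> s g; rewrite cfunJ ?inE.
under eq_bigr => h _ do rewrite specht_charE mulrCA mulr_sumr.
rewrite -mulr_sumr exchange_big /= (reindex_inj (@invg_inj _)) /=.
under eq_bigr => g _ do under eq_bigr => h _ do rewrite invgK.
rewrite ysym_conj_sum; last by case: ysym_equivariant.
by rewrite -/kappa mulKf ?mulVf ?mulr1 // kappa_neq0.
Qed.

End YoungCombinatorics.

(** * Frobenius characters *)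

(** Frobenius' formula: the coefficient of X^b in the product of the Vandermonde
    alternant and of the power sums of the cycle lengths of [s].  A colouring fixed
    by [s] chooses one variable for each cycle, hence a monomial of this product. *)
Definition frob_char k (b : 'I_k -> nat) n (s : 'S_n) : int :=
  \sum_(f : {ffun 'I_n -> 'I_k} | fixedby s f) alt_coef delta b (content f).

Lemma content_fst (X I J : finType) (F : {ffun X -> I * J}) :
  content [ffun x => (F x).1] = [ffun i => row_sum (content F) i].
Proof.
apply/ffunP => i; rewrite !ffunE /row_sum.
under [RHS]eq_bigr => j _ do rewrite ffunE.
rewrite exchange_big /=; apply: eq_bigr => x _; rewrite ffunE.
case: (F x) => a b /=; rewrite (bigD1 b) //= xpair_eqE eqxx andbT big1 ?addn0 //.
by move=> j nj; rewrite xpair_eqE (eq_sym b) (negbTE nj) andbF.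
Qed.

Lemma content_snd (X I J : finType) (F : {ffun X -> I * J}) :
  content [ffun x => (F x).2] = [ffun j => col_sum (content F) j].
Proof.
apply/ffunP => i; rewrite !ffunE /col_sum.
under [RHS]eq_bigr => j _ do rewrite ffunE.
rewrite exchange_big /=; apply: eq_bigr => x _; rewrite ffunE.
case: (F x) => a b /=; rewrite (bigD1 a) //= xpair_eqE eqxx /= big1 ?addn0 //.
by move=> j nj; rewrite xpair_eqE (eq_sym a) (negbTE nj).
Qed.

Lemma sum_pair_fixed n (I J : finType) (s : 'S_n)
    (H : {ffun I -> nat} -> int) (K : {ffun J -> nat} -> int) :
  (\sum_(f : {ffun 'I_n -> I} | fixedby s f) H (content f)) *
  (\sum_(g : {ffun 'I_n -> J} | fixedby s g) K (content g))
  = \sum_(F : {ffun 'I_n -> I * J} | fixedby s F)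
      H [ffun i => row_sum (content F) i] * K [ffun j => col_sum (content F) j].
Proof.
rewrite big_distrlr pair_big_dep /=.
pose pr (F : {ffun 'I_n -> I * J}) := ([ffun x => (F x).1], [ffun x => (F x).2]).
pose mk (p : {ffun 'I_n -> I} * {ffun 'I_n -> J}) := [ffun x => (p.1 x, p.2 x)].
have mkK : cancel mk pr.
  by case=> f g; congr (_, _); apply/ffunP => x; rewrite !ffunE.
have prK : cancel pr mk.
  by move=> F; apply/ffunP => x; rewrite !ffunE -surjective_pairing.
rewrite (reindex pr); last by apply: onW_bij; exists mk.
apply: eq_big => [F|F _]; last by rewrite -content_fst -content_snd.
rewrite /fixedby; apply/andP/forallP => [[/forallP h1 /forallP h2] x|h].
  apply/eqP; rewrite [LHS]surjective_pairing [RHS]surjective_pairing.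
  by have := h1 x; have := h2 x; rewrite !ffunE => /eqP -> /eqP ->.
by split; apply/forallP => x; rewrite !ffunE (eqP (h x)).
Qed.

Lemma rearr_sign_refl k (b : 'I_k -> nat) : injective b -> rearr_sign b b = 1.
Proof.
move=> injb; rewrite /rearr_sign /alt_coef (big_pred1 1%g) ?odd_perm1 // => w /=.
apply/forallP/eqP => [h|-> i]; last by rewrite perm1.
by apply/permP => i; rewrite perm1; apply: injb; apply/eqP/h.
Qed.

Lemma frob_norm k (b : 'I_k -> nat) n : injective b ->
  (\sum_i b i = n + 'C(k, 2))%N ->
  \sum_(s : 'S_n) frob_char b s * frob_char b s = n`!%:R.
Proof.
move=> injb sb.
under eq_bigr => s _ do rewrite /frob_char
  (@sum_pair_fixed _ _ _ _ (fun f => alt_coef delta b f) (fun f => alt_coef delta b f)).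
rewrite (@burnside_content n n.+1 _ (fun m => alt_coef delta b [ffun i => row_sum m i] *
  alt_coef delta b [ffun i => col_sum m i])) // -[RHS]mulr1 -(rearr_sign_refl injb).
congr (_ * _); rewrite -(alternant_orthogonality (ltnSn n) sb sb).
by apply: eq_bigr => M _; congr (_ * _); apply: eq_alt_coef => // i; rewrite ffunE.
Qed.

Lemma fixedbyV n (Z : finType) (s : 'S_n) (f : {ffun 'I_n -> Z}) :
  fixedby s^-1%g f = fixedby s f.
Proof.
apply/forallP/forallP => h x.
  by have := h (s x); rewrite permK eq_sym.
by have := h (s^-1 x)%g; rewrite permKV eq_sym.
Qed.

Lemma frobV k (b : 'I_k -> nat) n (s : 'S_n) : frob_char b s^-1%g = frob_char b s.
Proof. by apply: eq_bigl => f; rewrite fixedbyV. Qed.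

Lemma frobJ k (b : 'I_k -> nat) n (s g : 'S_n) : frob_char b (s ^ g)%g = frob_char b s.
Proof.
rewrite /frob_char (reindex (fun f : {ffun 'I_n -> 'I_k} => [ffun x => f (g^-1 x)%g])); last first.
  apply: onW_bij; exists (fun f : {ffun 'I_n -> 'I_k} => [ffun x => f (g x)]) => f;
  by apply/ffunP => x; rewrite !ffunE ?permK ?permKV.
apply: eq_big => [f|f _]; last by rewrite content_perm.
apply/forallP/forallP => h x.
  by have := h (g x); rewrite !ffunE permK permJ permK.
by rewrite !ffunE -{1}(permKV g x) permJ permK.
Qed.

(** The difference of the two sums is half the sum of the squares of the i - w i. *)
Lemma rearrangement k (w : 'S_k) :
  (\sum_(i < k) i * i <= \sum_(i < k) i * w i)%N -> w = 1%g.
Proof.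
move=> le.
have e : (\sum_(i < k) (i * i + w i * w i) = (\sum_(i < k) i * i).*2)%N.
  rewrite big_split /= -addnn; congr (_ + _)%N.
  by rewrite [RHS](reindex_inj (@perm_inj _ w)).
have leE (i : 'I_k) : ((i * w i).*2 <= i * i + w i * w i)%N.
  by rewrite -mul2n !mulnn; apply: (nat_Cauchy i (w i)).1.
apply/permP => i; rewrite perm1; apply: val_inj => /=.
apply/eqP; apply: contraTT le => ne; rewrite -ltnNge -ltn_double -e -muln2.
rewrite big_distrl (bigD1 i) //= [X in (_ < X)%N](bigD1 i) //= -addSn leq_add //.
  have [l1 l2] := nat_Cauchy i (w i).
  rewrite muln2 -mul2n !mulnn ltn_neqAle l1 l2 andbT.
  by rewrite eq_sym.
by apply: leq_sum => j _; rewrite muln2.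
Qed.

(** * Specht characters are Frobenius characters *)

(** For k parts, the beta-numbers of the partition in increasing order: the parts
    are read from the last one and made distinct by adding 0, 1, ... *)
Definition beta_number (la : seq nat) k (i : 'I_k) : nat := (nth 0 la (rev_ord i) + i)%N.

Section SpechtFrobenius.

Variables (n : nat) (la : seq nat).
Hypotheses (la_sorted : sorted geq la) (la_size : sumn la = n).

Local Notation k := (size la).
Local Notation R := (row_stab n la).
Local Notation C := (col_stab n la).
Local Notation ysym := (ysym la).
Local Notation kappa := (kappa n la).

Lemma ysym_sumE (F : 'S_n -> algC) :
  \sum_h ysym h * F h = \sum_(p in R) \sum_(q in C) (-1) ^+ odd_perm q * F (p * q)%g.
Proof.
under eq_bigr => h _ do rewrite /ysym mulr_suml.
rewrite exchange_big /=; apply: eq_bigr => p _.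
under eq_bigr => h _ do rewrite mulr_suml.
rewrite (exchange_big_dep (fun q => q \in C)) /=; last by move=> g q _ /andP[].
apply: eq_bigr => q Cq; rewrite (big_pred1 (p * q)%g) // => g /=.
by rewrite Cq eq_sym.
Qed.

(** For fixed p, suppose that f after p^-1 takes the same value at two cells of a
    column.  Multiplying q by the transposition of these cells changes the sign of
    the term of p q, and does not change whether p q fixes f. *)
Lemma ysym_fix_neq0 (Z : finType) (f : {ffun 'I_n -> Z}) :
  \sum_h ysym h * (fixedby h f)%:R != 0 ->
  exists p : 'S_n, forall i j : 'I_n, same_col la i j -> f (p i) = f (p j) -> i = j.
Proof.
rewrite ysym_sumE => nz.
have [/existsP[p /forallP hp]|no] := boolP [exists p : 'S_n, forall i : 'I_n, forall j : 'I_n,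
   (same_col la i j && (f (p i) == f (p j))) ==> (i == j)].
  exists p => i j cij fij; apply/eqP.
  by move/forallP: (hp i) => /(_ j); rewrite cij fij eqxx.
case/eqP: nz; apply: big1 => p _.
have := no; rewrite negb_exists => /forallP/(_ p^-1%g).
rewrite negb_forall => /existsP[i]; rewrite negb_forall => /existsP[j].
rewrite negb_imply => /andP[/andP[cij /eqP fij] nij].
set W := (X in X = 0); suff : W = - W.
  by move/eqP; rewrite -addr_eq0 -mulr2n -mulr_natl mulf_eq0 pnatr_eq0 => /eqP.
pose t := tperm i j; have Ct : t \in C by apply: tperm_col_stab.
rewrite {1}/W (reindex_inj (mulgI t)) /= -sumrN; apply: eq_big => [q|q _].
  have colt x : reshape_offset la (t x) = reshape_offset la x by move/col_stabP: Ct.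
  apply/col_stabP/col_stabP => h x; last by rewrite permM h colt.
  by have := h (t x); rewrite permM tpermK => ->; rewrite colt.
rewrite odd_permM odd_tperm nij addTb signrN mulNr; congr (- (_ * (nat_of_bool _)%:R)).
rewrite /fixedby; apply/forallP/forallP => h x.
  have := h (p^-1 (t (p x)))%g; rewrite !permM permKV tpermK => /eqP ->.
  by case: tpermP => [e|e|_ _]; rewrite ?permK // -?fij -?e ?permK // fij -?e ?permK.
have := h (p^-1 (t (p x)))%g; rewrite !permM permKV => /eqP ->.
by case: tpermP => [e|e|_ _]; rewrite ?permK // -?fij -?e ?permK // fij -?e ?permK.
Qed.

Local Notation beta := (@beta_number la k).

Lemma sum_rev_ord (F : nat -> nat) : (\sum_(i < k) F (rev_ord i) = \sum_(i < k) F i)%N.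
Proof. by rewrite [RHS](reindex_inj rev_ord_inj). Qed.

Lemma sum_beta_number : (\sum_i beta i = n + 'C(k, 2))%N.
Proof.
rewrite /beta_number big_split /= (sum_rev_ord (nth 0%N la)) sum_ord_nat -la_size sumnE.
by rewrite (big_nth 0%N) big_mkord.
Qed.

Lemma beta_number_inj : injective beta.
Proof.
have lt (i j : 'I_k) : (i < j)%N -> (beta i < beta j)%N.
  move=> ij; rewrite /beta_number /= -addnS leq_add //; apply: part_anti => //; lia.
move=> i j e; apply: val_inj => /=.
by case: (ltngtP i j) => // /lt; rewrite e ltnn.
Qed.

Definition row_ord (x : 'I_n) : 'I_k :=
  Ordinal (reshape_indexP (eq_rect_r (fun m => x < m)%N (ltn_ord x) la_size)).

(** Rows are coloured from the last one, in accordance with [beta_number]. *)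
Definition row_colour : {ffun 'I_n -> 'I_k} := [ffun x => rev_ord (row_ord x)].

Lemma content_row_colour i : content row_colour i = nth 0%N la (rev_ord i).
Proof.
have lec (r : 'I_k) : (#|[pred x : 'I_n | row_ord x == r]| <= nth 0%N la r)%N.
  have := @card_below _ [pred x : 'I_n | row_ord x == r]
    (fun x : 'I_n => reshape_offset la x) (nth 0%N la r).
  have -> : #|[pred y : 'I_n | [pred x | row_ord x == r] y & (reshape_offset la y < nth 0 la r)%N]|
     = #|[pred x : 'I_n | row_ord x == r]|.
    apply: eq_card => x; rewrite !inE andb_idr // => /eqP <- /=.
    exact: col_lt.
  apply=> x y; rewrite !inE => /eqP ex /eqP ey ec.
  apply: (cell_inj (la := la)) => //.
  by have := congr1 val (etrans ex (esym ey)).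
have sumc : (\sum_(r < k) #|[pred x : 'I_n | row_ord x == r]| = \sum_(r < k) nth 0 la r)%N.
  transitivity n.
    have := mass_content [ffun x => row_ord x]; rewrite card_ord; move=> e; rewrite -[RHS]e.
    apply: eq_bigr => r _; rewrite ffunE -sum1_card big_mkcond.
    by apply: eq_bigr => x _; rewrite inE ffunE; case: eqP.
  by have := esym la_size; rewrite sumnE (big_nth 0%N) big_mkord.
have -> : content row_colour i = #|[pred x : 'I_n | row_ord x == rev_ord i]|.
  rewrite ffunE -sum1_card [RHS]big_mkcond.
  by apply: eq_bigr => x _; rewrite inE ffunE (can2_eq rev_ordK rev_ordK); case: eqP.
apply/eqP; rewrite eqn_leq lec /= leqNgt; apply/negP => lt.
move/eqP: sumc; apply/negP; rewrite neq_ltn; apply/orP; left.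
rewrite (bigD1 (rev_ord i)) //= [X in (_ < X)%N](bigD1 (rev_ord i)) //= -addSn.
by rewrite leq_add // leq_sum.
Qed.

(** Weight each colour by the number of the row it stands for.  The sum of the
    weights of a function injective on columns is at least that of the row numbers,
    by [col_injective_sum]; a content that differs from the beta-numbers by a
    permutation w has at most this sum, and equality forces w to be the identity. *)
Lemma alt_col_injective (f : {ffun 'I_n -> 'I_k}) (p : 'S_n) :
  (forall i j : 'I_n, same_col la i j -> f (p i) = f (p j) -> i = j) ->
  alt_coef delta beta (content f) = (content f == content row_colour)%:R.
Proof.
move=> injf; pose h (x : 'I_n) : nat := rev_ord (f (p x)).
have injh : col_injective la h.
  by move=> i j cij e; apply: (injf i j cij); apply: rev_ord_inj; apply: val_inj.
have := col_injective_sum la_sorted la_size injh.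
have sumE (g : {ffun 'I_n -> 'I_k}) :
   (\sum_x (rev_ord (g x) : nat) = \sum_i rev_ord i * content g i)%N.
  under [RHS]eq_bigr => i _ do rewrite ffunE big_distrr /=.
  rewrite exchange_big /=; apply: eq_bigr => x _.
  by rewrite (bigD1 (g x)) //= eqxx muln1 big1 ?addn0 // => i; rewrite eq_sym => /negbTE ->; rewrite muln0.
have -> : (\sum_x h x = \sum_i rev_ord i * content f i)%N.
  by rewrite -sumE [RHS](reindex_inj (@perm_inj _ p)).
have -> : (\sum_(x : 'I_n) reshape_index la x = \sum_i rev_ord i * content row_colour i)%N.
  by rewrite -sumE; apply: eq_bigr => x _; rewrite ffunE rev_ordK.
move=> le.
have w1 (w : 'S_k) : [forall i, content f i + w i == beta i]%N -> w = 1%g.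
  move=> /forallP hw; apply: rearrangement.
  have e1 : (\sum_i rev_ord i * content f i + \sum_(i < k) rev_ord i * w i =
     \sum_i rev_ord i * content row_colour i + \sum_(i < k) rev_ord i * i)%N.
    rewrite -!big_split; apply: eq_bigr => i _ /=; rewrite -!mulnDr (eqP (hw i)).
    by rewrite content_row_colour.
  (* As rev_ord i + i = k - 1, the weights rev_ord i can be replaced by i. *)
  have e2 (u : 'S_k) : (\sum_(i < k) rev_ord i * u i + \sum_(i < k) i * u i = k.-1 * \sum_(i < k) i)%N.
    rewrite -big_split /= [in RHS](reindex_inj (@perm_inj _ u)) big_distrr /=.
    by apply: eq_bigr => i _; rewrite -mulnDl; congr (_ * _)%N; have := ltn_ord i; lia.
  have e3 : (\sum_(i < k) rev_ord i * i + \sum_(i < k) i * i = k.-1 * \sum_(i < k) i)%N.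
    by rewrite -(e2 1%g); congr (_ + _)%N; apply: eq_bigr => i _; rewrite perm1.
  by move: e1 le (e2 w); rewrite -e3; lia.
(* For w = 1 the condition says that f has the content of the row colouring. *)
have cond1 : [forall i, content f i + (1%g : 'S_k) i == beta i]%N
    = (content f == content row_colour).
  apply/forallP/eqP => [h1|-> i]; last by rewrite perm1 content_row_colour.
  apply/ffunP => i; rewrite content_row_colour; apply/eqP.
  by have := h1 i; rewrite perm1 eqn_add2r.
rewrite -cond1 /alt_coef; case: (boolP [forall i, _]) => h1.
  rewrite (big_pred1 1%g) ?odd_perm1 // => w /=.
  by apply/idP/eqP => [/w1|->].
rewrite big_pred0 // => w; apply/negbTE; apply: contra h1 => hw.
by rewrite -(w1 w hw).
Qed.

(** The left-hand side is the value, at the Young symmetrizer, of the permutation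
    character of the action on the cosets of the row stabilizer. *)
Lemma sum_ysym_fix :
  \sum_(f : {ffun 'I_n -> 'I_k} | content f == content row_colour)
     \sum_h ysym h * (fixedby h f)%:R = kappa.
Proof.
pose Z (f : {ffun 'I_n -> 'I_k}) := \sum_h ysym h * (fixedby h f)%:R.
have f0E x y : (row_colour x == row_colour y) = (reshape_index la x == reshape_index la y).
  by rewrite !ffunE (inj_eq rev_ord_inj).
have R1 : 1%g \in R by apply/row_stabP => x; rewrite perm1.
have R0 : #|R|%:R != 0 :> algC.
  by rewrite pnatr_eq0 -lt0n; apply/card_gt0P; exists 1%g.
apply: (mulfI R0); rewrite -/Z.
transitivity (\sum_(x : 'S_n) Z [ffun y => row_colour (x y)]).
  rewrite (partition_big (fun x : 'S_n => [ffun y => row_colour (x y)])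
    (fun f => content f == content row_colour)); last first.
    by move=> x _; rewrite /= content_perm.
  rewrite mulr_sumr; apply: eq_bigr => f /eqP cf.
  have [s0 es0] : exists s : 'S_n, forall x, f x = row_colour (s x).
    exact: same_content_perm.
  rewrite [RHS](eq_bigr (fun=> Z f)); last by move=> x /eqP <-.
  rewrite [RHS](reindex_inj (mulgI s0)) mulr_natl -sumr_const /=.
  apply: eq_bigl => p; apply/row_stabP/eqP => [hp|/ffunP hp y].
    by apply/ffunP => y; rewrite ffunE permM es0; apply/eqP; rewrite f0E hp.
  apply/eqP; rewrite -f0E; have := hp (s0^-1 y)%g.
  by rewrite ffunE permM permKV es0 permKV => ->.
have [cl cr] := ysym_equivariant n la.
have := @ysym_conj_sum _ _ la_sorted la_size (fun h => (h \in R)%:R).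
rewrite (_ : \sum_h _ * _ = #|R|%:R); last first.
  rewrite -sum1_card natr_sum [RHS]big_mkcond; apply: eq_bigr => h _ /=.
  case: ifP => Rh; rewrite ?mul0r // mul1r -[h^-1%g]mulg1 cl ?row_stabV //.
  exact: ysym1.
rewrite [RHS]mulrC => <-; last by move=> p g Rp; rewrite row_stabM.
rewrite [RHS](reindex_inj (@invg_inj _)) /=; apply: eq_bigr => x _.
rewrite /Z [RHS](reindex_inj (@invg_inj _)) [RHS](reindex_inj (@conjg_inj _ x)) /=.
apply: eq_bigr => h _; rewrite mulrC !invgK; congr (_ * _); last first.
  by rewrite conjgE !mulgA mulgV mul1g mulgK.
congr (nat_of_bool _)%:R; rewrite row_stabV.
apply/forallP/row_stabP => hh y.
  have := hh (x^-1 y)%g; rewrite !ffunE permKV (inj_eq rev_ord_inj) => /eqP.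
  by move/(congr1 val) => /= <-; rewrite conjgE !permM.
by rewrite !ffunE (inj_eq rev_ord_inj) -val_eqE /= -(hh (x y)) conjgE !permM permK.
Qed.

Lemma sum_ysym_frob : \sum_(h : 'S_n) ysym h * (frob_char beta h)%:~R = kappa.
Proof.
rewrite -sum_ysym_fix [RHS]big_mkcond /=.
transitivity (\sum_(f : {ffun 'I_n -> 'I_k}) (alt_coef delta beta (content f))%:~R *
   \sum_h ysym h * (fixedby h f)%:R).
  under [RHS]eq_bigr => f _ do rewrite mulr_sumr.
  rewrite exchange_big; apply: eq_bigr => h _ /=.
  rewrite /frob_char raddf_sum mulr_sumr big_mkcond; apply: eq_bigr => f _ /=.
  by rewrite mulrCA; case: fixedby; rewrite ?mulr1 // !mulr0.
apply: eq_bigr => f _.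
case: (eqVneq (\sum_h ysym h * (fixedby h f)%:R) 0) => [->|/ysym_fix_neq0[p hp]].
  by rewrite mulr0 if_same.
by rewrite (alt_col_injective hp); case: ifP; rewrite ?mul1r ?mul0r.
Qed.

(** Both class functions have norm 1 and their inner product is 1, so the norm of
    their difference is 0. *)
Lemma specht_char_frob (s : 'S_n) : specht_char n la s = (frob_char beta s)%:~R.
Proof.
pose chi := specht_char n la; pose D (s : 'S_n) : algC := (frob_char beta s)%:~R.
have DV t : D t^-1%g = D t by rewrite /D frobV.
have E1 : \sum_t chi t * (chi t)^* = n`!%:R.
  rewrite -(specht_norm la_sorted la_size); apply: eq_bigr => t _.
  by rewrite -char_inv ?cfRepr_char.
have E2 : \sum_t chi t * D t = n`!%:R.
  have := @specht_sum _ _ la_sorted la_size D (fun t g => congr1 intr (frobJ _ t g)).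
  rewrite /D sum_ysym_frob mulVf ?mulr1 ?kappa_neq0 // => <-.
  by apply: eq_bigr => t _; rewrite frobV.
have E3 : \sum_t D t * D t = n`!%:R.
  have := frob_norm beta_number_inj sum_beta_number => /(congr1 (fun z => z%:~R : algC)).
  by rewrite raddf_sum /= natz -pmulrn => <-; apply: eq_bigr => t _; rewrite rmorphM.
have DR t : (D t)^* = D t by rewrite /D rmorph_int.
have E4 : \sum_t D t * (chi t)^* = n`!%:R.
  rewrite -[RHS](rmorph_nat Num.conj) -E2 rmorph_sum; apply: eq_bigr => t _.
  by rewrite rmorphM mulrC; congr (_ * _); exact/esym/DR.
have : \sum_t `|chi t - D t| ^+ 2 = 0.
  rewrite (eq_bigr (fun t => chi t * (chi t)^* - chi t * D t - D t * (chi t)^* + D t * D t)).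
    by rewrite big_split !sumrB /= E1 E2 E3 E4 subrr sub0r addNr.
  move=> t _; rewrite normCK.
  have -> : (chi t - D t)^* = (chi t)^* - D t.
    by rewrite rmorphB; congr (_ - _); apply: DR.
  by rewrite mulrBl !mulrBr opprB addrA addrAC.
move/eqP; rewrite psumr_eq0 => [|t _]; last by rewrite exprn_ge0.
move=> /allP/(_ s); rewrite mem_index_enum => /(_ isT).
by rewrite expf_eq0 normr_eq0 subr_eq0 /= => /eqP.
Qed.

End SpechtFrobenius.

(** * Words describing what is removed from a staircase *)

Definition step (a b : nat) : bool := (b <= a.+1)%N.

(** Each word e codes a partition alpha contained in the staircase: e_i is the
    number of cells outside alpha in the row of length i + 1.  For alpha to be a
    partition, e_i can grow by at most 1 from each row to the next longer one. *)
Fixpoint words k : seq (seq nat) :=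
  if k is k'.+1 then
    [seq rcons e x | e <- words k', x <- iota 0 (last 0%N e).+2]
  else [:: [::]].

Lemma mem_words k e : (e \in words k) = (size e == k) && path step 0%N e.
Proof.
elim: k e => [|k IH] e; first by rewrite inE -size_eq0; case: e.
apply/allpairsPdep/idP => [[u [x [uw xw ->]]]|].
  move: uw; rewrite IH => /andP[/eqP su pu].
  rewrite size_rcons su eqxx rcons_path pu /= /step.
  by move: xw; rewrite mem_iota.
case/lastP: e => [|u x] //; rewrite size_rcons eqSS rcons_path andbA -IH.
case/andP => uw ux; exists u, x; split=> //.
by rewrite mem_iota.
Qed.

Lemma uniq_words k : uniq (words k).
Proof.
elim: k => // k IH.
apply: (@allpairs_uniq_dep _ _ _ _ _ (fun e => iota 0 (last 0%N e).+2)) => //.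
  by move=> e _; apply: iota_uniq.
by move=> [e x] [u y] _ _ /= /rcons_inj [-> ->].
Qed.

Lemma step_nth e i j : path step 0%N e -> (i <= j)%N -> (j < size e)%N ->
  (nth 0 e j + i <= nth 0 e i + j)%N.
Proof.
move=> pe; elim: j => [|j IH] lij ltj; first by move: lij; rewrite leqn0 => /eqP ->.
case: (ltngtP i j.+1) lij => // [lt _|-> _ //].
have := pathP 0%N pe; move/(_ j.+1 ltj); rewrite /step /=.
by have := IH lt (ltnW ltj); lia.
Qed.

Lemma nth_word_le e i : path step 0%N e -> (i < size e)%N -> (nth 0 e i <= i.+1)%N.
Proof.
move=> pe lti; have lt0 : (0 < size e)%N by apply: leq_trans lti.
have := step_nth pe (leq0n i) lti; have := pathP 0%N pe; move/(_ 0%N lt0); rewrite /step /=.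
lia.
Qed.

Section Sorting.
Variable k : nat.
Local Notation beta := (fun i : 'I_k => i.*2.+1).

(** The beta-numbers of the partition coded by [e]; those of the staircase are the
    odd numbers. *)
Definition word_shape (e : seq nat) (i : 'I_k) : nat := (i.*2.+1 - nth 0 e i)%N.

Lemma word_shape_lt e (i j : 'I_k) : e \in words k -> (i < j)%N ->
  (word_shape e i < word_shape e j)%N.
Proof.
rewrite mem_words => /andP[/eqP se pe] ij; rewrite /word_shape.
have := nth_word_le pe; rewrite se => le.
have := step_nth pe (ltnW ij); rewrite se => /(_ (ltn_ord j)).
have := le _ (ltn_ord i); have := le _ (ltn_ord j); lia.
Qed.

Lemma word_shape_inj e : e \in words k -> injective (word_shape e).
Proof.
move=> we i j; case: (ltngtP i j) => [lt|lt|/val_inj //] e1.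
  by have := word_shape_lt we lt; rewrite e1 ltnn.
by have := word_shape_lt we lt; rewrite e1 ltnn.
Qed.

Lemma card_ord_lt m : (m <= k)%N -> #|[pred i : 'I_k | (i < m)%N]| = m.
Proof.
move=> lem; rewrite -sum1_card -[RHS]card_ord -[RHS]sum1_card.
by rewrite (big_ord_widen k (fun=> 1%N)) //.
Qed.

Lemma sorting (x : 'I_k -> nat) : injective x ->
  exists p : 'S_k, forall i j, (p i < p j)%N = (x i < x j)%N.
Proof.
move=> injx; pose r i := #|[pred j | (x j < x i)%N]|.
have rlt i j : (x i < x j)%N -> (r i < r j)%N.
  move=> lt; apply: proper_card; apply/properP; split.
    by apply/subsetP => z; rewrite !inE => /ltn_trans; apply.
  by exists i; rewrite inE ?ltnn.
have rk i : (r i < k)%N.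
  rewrite -[X in (_ < X)%N]card_ord; apply: proper_card; apply/properP; split.
    by apply/subsetP.
  by exists i; rewrite ?inE ?ltnn.
have rE i j : (r i < r j)%N = (x i < x j)%N.
  apply/idP/idP => [|/rlt //]; case: (ltngtP (x i) (x j)) => // [/rlt lt|/injx -> //].
    by rewrite ltnNge (ltnW lt).
  by rewrite ltnn.
have injr : injective (fun i => Ordinal (rk i)).
  move=> i j /(congr1 val) /= e; apply: injx.
  by case: (ltngtP (x i) (x j)) => // /rlt; rewrite e ltnn.
by exists (perm injr) => i j; rewrite !permE; apply: rE.
Qed.

(** After sorting, [x] is still bounded by the odd numbers: the r + 1 values at the
    places 0, ..., r are at most 2 r + 1, so the r-th smallest value is too. *)
Lemma sorting_word (x : 'I_k -> nat) : injective x -> (forall i, x i <= i.*2.+1)%N ->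
  exists2 e, e \in words k & exists p : 'S_k, forall i, word_shape e (p i) = x i.
Proof.
move=> injx lex; have [p ep] := sorting injx.
pose b (r : 'I_k) := x (p^-1 r)%g.
have bmono (i j : 'I_k) : (i < j)%N -> (b i < b j)%N by rewrite -ep !permKV.
have ble (r : 'I_k) : (b r <= r.*2.+1)%N.
  rewrite leqNgt; apply/negP => lt.
  have injp : {in [pred i : 'I_k | (i < r.+1)%N] &, injective (fun i => p i : nat)}.
    by move=> i j _ _ /val_inj /perm_inj.
  have := card_below r injp.
  have -> : #|[pred y : 'I_k | [pred i : 'I_k | (i < r.+1)%N] y & (p y < r)%N]| = r.+1.
    rewrite -[RHS](card_ord_lt (ltn_ord r)); apply: eq_card => i; rewrite !inE andb_idr // ltnS => lei.
    have := ep i (p^-1 r)%g; rewrite permKV => ->.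
    by apply: leq_ltn_trans (lex i) _; apply: leq_ltn_trans lt; lia.
  by rewrite ltnn.
exists [seq (i.*2.+1 - b i)%N | i : 'I_k <- enum 'I_k]; last first.
  exists p => i; rewrite /word_shape (nth_map i) ?size_enum_ord // nth_ord_enum.
  by have := ble (p i); rewrite /b permK; lia.
rewrite mem_words size_map size_enum_ord eqxx; apply/(pathP 0%N) => j.
rewrite size_map size_enum_ord /step => ltj.
have ej (j' : 'I_k) : nth 0%N [seq (i.*2.+1 - b i)%N | i : 'I_k <- enum 'I_k] j' = (j'.*2.+1 - b j')%N.
  by rewrite (nth_map j') ?size_enum_ord // nth_ord_enum.
rewrite (ej (Ordinal ltj)) /=; case: j ltj => [|j] ltj /=; first by rewrite /=; lia.
rewrite (ej (Ordinal (ltnW ltj))) /=.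
have := bmono (Ordinal (ltnW ltj)) (Ordinal ltj) (ltnSn j).
have := ble (Ordinal ltj); have := ble (Ordinal (ltnW ltj)) => /=; lia.
Qed.

Lemma increasing_perm_eq (b c : 'I_k -> nat) (p : 'S_k) :
  (forall i j : 'I_k, (i < j)%N -> (b i < b j)%N) ->
  (forall i j : 'I_k, (i < j)%N -> (c i < c j)%N) ->
  (forall i, b (p i) = c i) -> p = 1%g.
Proof.
move=> mb mc e.
have pm (i j : 'I_k) : (i < j)%N -> (p i < p j)%N.
  move=> ij; have := mc _ _ ij; rewrite -!e.
  case: (ltngtP (p i) (p j)) => // [/mb|/val_inj ->]; rewrite ?ltnn //.
  by move=> h1 h2; have := ltn_trans h1 h2; rewrite ltnn.
have ge (i : 'I_k) : (i <= p i)%N.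
  case: i => i; elim: i => // i IH lti.
  have := pm (Ordinal (ltnW lti)) (Ordinal lti) (ltnSn i).
  by apply: leq_ltn_trans; apply: IH.
have s : (\sum_(i < k) p i = \sum_(i < k) i)%N by rewrite [RHS](reindex_inj (@perm_inj _ p)).
apply/permP => i; rewrite perm1; apply: val_inj => /=.
apply/eqP; rewrite eqn_leq ge andbT leqNgt; apply/negP => lt.
have : (\sum_(i < k) i < \sum_(i < k) p i)%N.
  rewrite (bigD1 i) //= [X in (_ < X)%N](bigD1 i) //= -addSn leq_add //.
  by apply: leq_sum.
by rewrite s ltnn.
Qed.

Lemma rearr_signC (x y : 'I_k -> nat) : rearr_sign x y = rearr_sign y x.
Proof.
rewrite /rearr_sign /alt_coef (reindex_inj (@invg_inj _)) /=.
apply: eq_big => [w|w _]; last by rewrite odd_permV.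
apply/forallP/forallP => h i; have := h (w i); rewrite ?permK => e.
  by rewrite eq_sym.
have := h (w^-1 i)%g; rewrite permKV => e'.
by rewrite eq_sym.
Qed.

(** Two sequences of distinct numbers are rearrangements of each other if and only
    if both are rearrangements of the same increasing sequence, and the latter is
    coded by a word; the signs multiply. *)
Lemma rearr_sign_words (x y : 'I_k -> nat) : (forall i, x i <= i.*2.+1)%N ->
  rearr_sign x y = \sum_(e <- words k)
     alt_coef (word_shape e) x (fun=> 0%N) * alt_coef (word_shape e) y (fun=> 0%N).
Proof.
move=> lex; have [/injectiveP injx|] := boolP (injectiveb x); last first.
  case/injectivePn => i [j nij exy].
  rewrite /rearr_sign (alt_eq0_r _ nij exy) // big1 // => e _.
  by rewrite (alt_eq0_r _ nij exy) // mul0r.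
have [e we [p ep]] := sorting_word injx lex.
rewrite (bigD1_seq e) ?uniq_words //= big1_seq ?addr0; last first.
  move=> e' /andP[ne we']; rewrite [X in X * _](_ : _ = 0) ?mul0r //.
  rewrite /alt_coef big_pred0 // => w; apply/negP => /forallP h.
  have hw i : word_shape e' ((p^-1 * w)%g i) = word_shape e i.
    have := h (p^-1 i)%g; rewrite add0n permM => /eqP ->.
    by rewrite -ep permKV.
  have w1 := increasing_perm_eq (fun i j => word_shape_lt we') (fun i j => word_shape_lt we) hw.
  case/eqP: ne; move: we we'; rewrite !mem_words => /andP[/eqP se pe] /andP[/eqP se' pe'].
  apply: (@eq_from_nth _ 0%N); rewrite se' ?se // => i lti.
  have := hw (Ordinal lti); rewrite w1 perm1 /word_shape /=.
  have := @nth_word_le e i pe; have := @nth_word_le e' i pe'; rewrite se se'; lia.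
have -> : alt_coef (word_shape e) x (fun=> 0%N) = (-1) ^+ p.
  rewrite /alt_coef (big_pred1 p) // => w; apply/forallP/eqP => [h|-> i]; last by rewrite ep.
  by apply/permP => i; apply: (word_shape_inj we); rewrite ep; apply/eqP/h.
rewrite rearr_signC /rearr_sign /alt_coef mulr_sumr [RHS](reindex_inj (mulIg p)) /=.
apply: eq_big => [w|w _].
  by apply: eq_forallb => i; rewrite permM ep.
by rewrite odd_permM signr_addb mulrCA -expr2 sqrr_sign mulr1.
Qed.

End Sorting.

(** * The Kronecker coefficient as a sum over words *)

(** The coefficient of h_(x 0) h_(x 1) ... in the Jacobi-Trudi determinant of the
    skew shape between the staircase and the partition coded by [e]. *)
Definition word_alt k (e : seq nat) (x : 'I_k -> nat) : int :=
  alt_coef (word_shape e) (fun i => i.*2.+1) x.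

Lemma sum_odd k : (\sum_(i < k) i.*2.+1 = 'C(k.+1, 2) + 'C(k, 2))%N.
Proof.
rewrite (eq_bigr (fun i : 'I_k => i + i.+1))%N; last by move=> i _; rewrite addnS addnn.
rewrite big_split /= sum_ord_nat addnC; congr (_ + _)%N.
by rewrite -sum_ord_nat big_ord_recl.
Qed.

(** Summing over the slice of an array that belongs to the long row: [x] and [y]
    are the margins of the other slices. *)
Lemma words_orthogonality k N n (x y : 'I_k -> nat) : (n < N)%N ->
  (\sum_i x i + n = 'C(k.+1, 2))%N -> (\sum_i y i + n = 'C(k.+1, 2))%N ->
  \sum_(M : {ffun 'I_k * 'I_k -> 'I_N} | mass (entries M) == n)
     alt_coef delta (fun i => i.*2.+1) (fun i => row_sum (entries M) i + x i)%N *
     alt_coef delta (fun i => i.*2.+1) (fun i => col_sum (entries M) i + y i)%N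
  = \sum_(e <- words k) word_alt e x * word_alt e y.
Proof.
move=> ltn sx sy.
under eq_bigr => M _ do rewrite !alt_shift mulrACA.
rewrite -mulr_sumr.
have we e (z : 'I_k -> nat) : word_alt e z = [forall i, z i <= i.*2.+1]%N%:R *
    alt_coef (word_shape e) (fun i => i.*2.+1 - z i)%N (fun=> 0%N).
  rewrite -(alt_shift (word_shape e) (fun i : 'I_k => i.*2.+1) (fun=> 0%N) z).
  by apply: eq_alt_coef.
under [RHS]eq_bigr => e _ do rewrite !we mulrACA.
rewrite -[RHS]mulr_sumr.
case: forallP => [lex|_]; last by rewrite !mul0r.
case: forallP => [ley|_]; last by rewrite mulr0 !mul0r.
have sub (z : 'I_k -> nat) : (forall i, z i <= i.*2.+1)%N ->
   (\sum_i z i + n = 'C(k.+1, 2))%N -> (\sum_(i < k) (i.*2.+1 - z i) = n + 'C(k, 2))%N.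
  move=> lez sz; have := sum_odd k.
  have -> : (\sum_(i < k) i.*2.+1 = \sum_(i < k) (i.*2.+1 - z i) + \sum_i z i)%N.
    by rewrite -big_split; apply: eq_bigr => i _ /=; rewrite subnK.
  by rewrite -sz; lia.
rewrite (alternant_orthogonality ltn (sub _ lex sx) (sub _ ley sy)); congr (_ * _).
by apply: rearr_sign_words => i; apply: leq_subr.
Qed.

Section Correction.
Variables (r d : nat) (c : 'I_r -> nat).
Hypothesis sum_c : (\sum_j c j = d + 'C(r, 2))%N.

(** The alternant coefficient for (n - d, nu) without the condition at the index of
    the long row; by [alt_coef_tail] that condition follows from the others, and so
    the coefficient depends on the colouring of the other rows only. *)
Definition alt_tail (m : 'I_r -> nat) : int :=
  \sum_(u : 'S_r.+1 | [forall j, m j + u (lift ord_max j) == c j]%N) (-1) ^+ u.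

Lemma eq_alt_tail m m' : m =1 m' -> alt_tail m = alt_tail m'.
Proof. by move=> e; apply: eq_bigl => u; apply: eq_forallb => j; rewrite e. Qed.

(** The values of u away from the last index add up to ['C(r.+1, 2)] minus the
    value there. *)
Lemma alt_tail_mass m (u : 'S_r.+1) :
  [forall j, m j + u (lift ord_max j) == c j]%N -> (\sum_j m j + r = d + u ord_max)%N.
Proof.
move/forallP => h.
have e1 : (\sum_j m j + \sum_j u (lift ord_max j) = d + 'C(r, 2))%N.
  by rewrite -sum_c -big_split; apply: eq_bigr => j _; apply/eqP/h.
have e2 : (\sum_(i < r.+1) u i = 'C(r.+1, 2))%N.
  by rewrite -sum_ord_nat [RHS](reindex_inj (@perm_inj _ u)).
rewrite big_ord_recr /= binS bin1 in e2.
have e3 : (\sum_j u (lift ord_max j) = \sum_(i < r) u (widen_ord (leqnSn r) i))%N.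
  apply: eq_bigr => j _; congr (nat_of_ord (u _)); apply: val_inj => /=.
  by rewrite /bump leqNgt ltn_ord.
move: e1 e2; rewrite e3; move: (\sum_j m j)%N (\sum_(i < r) _)%N 'C(r, 2) (nat_of_ord _) => A B C D; lia.
Qed.

Lemma alt_tail_eq0 m : (d < \sum_j m j)%N -> alt_tail m = 0.
Proof.
move=> lt; rewrite /alt_tail big_pred0 // => u; apply/negP => /alt_tail_mass.
move: lt; have := ltn_ord (u ord_max); move: (\sum_j m j)%N (nat_of_ord (u ord_max)) => A B; lia.
Qed.

Lemma alt_coef_tail n (b m : 'I_r.+1 -> nat) : (d <= n)%N ->
  (forall j, b (lift ord_max j) = c j) -> b ord_max = (n - d + r)%N ->
  (\sum_i m i = n)%N -> alt_coef delta b m = alt_tail (fun j => m (lift ord_max j)).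
Proof.
move=> ledn bl bm sm; apply: eq_bigl => u; apply/forallP/idP => [h|h i].
  by apply/forallP => j; rewrite -bl; apply: h.
case: (unliftP ord_max i) => [j ->|->].
  by move/forallP: h => /(_ j); rewrite bl.
have := alt_tail_mass h; rewrite bm.
have := sm; rewrite big_ord_recr /=.
have -> : (\sum_(i0 < r) m (widen_ord (leqnSn r) i0) = \sum_j m (lift ord_max j))%N.
  apply: eq_bigr => j _; congr m; apply: val_inj => /=.
  by rewrite /bump leqNgt ltn_ord.
move: (\sum_j _)%N (nat_of_ord (u ord_max)) => A B; lia.
Qed.

Definition pair_margin (I L : finType) (m : {ffun I * L -> nat}) : {ffun I -> nat} :=
  [ffun p => row_sum m p].

(** The terms of the arrays of mass [a], indexed also by the rows of nu, in which
    the skew shape coded by [e] is used; it does not depend on [N] ([block_sumE]). *)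
Definition block_sum N a k e : int :=
  \sum_(M : {ffun ('I_k * 'I_k) * 'I_r -> 'I_N} | mass (entries M) == a)
     word_alt e (row_sum (pair_margin (entries M))) *
     word_alt e (col_sum (pair_margin (entries M))) *
     alt_tail (col_sum (entries M)).

(** The character of the skew shape coded by [e]. *)
Definition word_char k e a (t : 'S_a) : int :=
  \sum_(f : {ffun 'I_a -> 'I_k} | fixedby t f) word_alt e (content f).

(** The class functions psi_a for which the character of (n - d, nu) is the sum
    over a of the characters induced from 1 x psi_a on the Young subgroups
    S_(n-a) x S_a. *)
Definition tail_char a (t : 'S_a) : int :=
  \sum_(f : {ffun 'I_a -> 'I_r} | fixedby t f) alt_tail (content f).

(** Burnside's lemma, used backwards: the arrays are the contents of triples of
    colourings. *)
Lemma block_sumE N a k e : (a < N)%N ->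
  a`!%:R * block_sum N a k e = \sum_(t : 'S_a) word_char k e t ^+ 2 * tail_char t.
Proof.
move=> ltaN.
have := @burnside_content _ _ _ (fun m : {ffun ('I_k * 'I_k) * 'I_r -> nat} =>
  word_alt e (row_sum (pair_margin m)) * word_alt e (col_sum (pair_margin m)) *
     alt_tail (col_sum m)) ltaN => <-.
apply: eq_bigr => t _; rewrite expr2 /word_char /tail_char.
rewrite (@sum_pair_fixed _ _ _ t (fun m => word_alt e m) (fun m => word_alt e m)).
rewrite (@sum_pair_fixed _ _ _ t (fun m => word_alt e [ffun i => row_sum m i] * word_alt e [ffun j => col_sum m j]) (fun m => alt_tail m)).
apply: eq_bigr => F _; congr (_ * _ * _).
- by apply: eq_alt_coef => // i; rewrite ffunE.
- by apply: eq_alt_coef => // i; rewrite ffunE.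
- by apply: eq_alt_tail => i; rewrite ffunE.
Qed.

(** An array is its slice for the long row together with the other slices, whose
    mass is at most [d] whenever they contribute; [words_orthogonality] evaluates
    the sum over the former. *)
Lemma alt_array_split k N (b : 'I_r.+1 -> nat) :
  let n := 'C(k.+1, 2) in
  (n < N)%N -> (d <= n)%N ->
  (forall j, b (lift ord_max j) = c j) -> b ord_max = (n - d + r)%N ->
  \sum_(M : {ffun ('I_k * 'I_k) * 'I_r.+1 -> 'I_N} | mass (entries M) == n)
     alt_coef delta (fun i => i.*2.+1) (row_sum (pair_margin (entries M))) *
     alt_coef delta (fun i => i.*2.+1) (col_sum (pair_margin (entries M))) *
     alt_coef delta b (col_sum (entries M))
  = \sum_(a < d.+1) \sum_(e <- words k) block_sum N a k e.
Proof.
move=> n ltnN ledn bl bm.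
pose Kt := ('I_k * 'I_k)%type.
pose mk (p : {ffun Kt * 'I_r -> 'I_N} * {ffun Kt -> 'I_N}) : {ffun Kt * 'I_r.+1 -> 'I_N} :=
  [ffun z => if unlift ord_max z.2 is Some j then p.1 (z.1, j) else p.2 z.1].
pose sp (M : {ffun Kt * 'I_r.+1 -> 'I_N}) : {ffun Kt * 'I_r -> 'I_N} * {ffun Kt -> 'I_N} :=
  ([ffun z => M (z.1, lift ord_max z.2)], [ffun q => M (q, ord_max)]).
have mkK : cancel mk sp.
  case=> M1 M0; congr (_, _); apply/ffunP => z; rewrite !ffunE /= ?liftK ?unlift_none //.
  by case: z.
have spK : cancel sp mk.
  move=> M; apply/ffunP => -[q i]; rewrite ffunE /=.
  by case: (unliftP ord_max i) => [j ->|->]; rewrite ffunE.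
rewrite (reindex mk); last by apply: onW_bij; exists sp.
have sum_last (F : 'I_r.+1 -> nat) :
   (\sum_i F i = \sum_j F (lift ord_max j) + F ord_max)%N.
  rewrite big_ord_recr /=; congr (_ + _)%N; apply: eq_bigr => j _.
  by congr F; apply: val_inj; rewrite /= /bump leqNgt ltn_ord.
have rowE (p : {ffun Kt * 'I_r -> 'I_N} * {ffun Kt -> 'I_N}) q :
    row_sum (entries (mk p)) q = (entries p.2 q + row_sum (entries p.1) q)%N.
  rewrite /row_sum sum_last addnC !ffunE /= unlift_none; congr (_ + _)%N.
  by apply: eq_bigr => j _; rewrite !ffunE /= liftK.
have colE (p : {ffun Kt * 'I_r -> 'I_N} * {ffun Kt -> 'I_N}) j :
    col_sum (entries (mk p)) (lift ord_max j) = col_sum (entries p.1) j.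
  by apply: eq_bigr => q _; rewrite !ffunE /= liftK.
have totE (I L : finType) (m : {ffun I * L -> nat}) : mass m = (\sum_q row_sum m q)%N.
  by rewrite /mass /row_sum pair_bigA; apply: eq_bigr => -[].
have totC (I L : finType) (m : {ffun I * L -> nat}) : mass m = (\sum_q col_sum m q)%N.
  by rewrite /mass /col_sum exchange_big pair_bigA; apply: eq_bigr => -[].
have totmk p : mass (entries (mk p)) = (mass (entries p.2) + mass (entries p.1))%N.
  by rewrite totE (eq_bigr _ (fun q _ => rowE p q)) big_split -totE.
transitivity (\sum_(M1 : {ffun Kt * 'I_r -> 'I_N}) \sum_(M0 : {ffun Kt -> 'I_N} |
   mass (entries M0) + mass (entries M1) == n)
   alt_coef delta (fun i => i.*2.+1) (fun i => row_sum (entries M0) i + row_sum (pair_margin (entries M1)) i)%N *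
   alt_coef delta (fun i => i.*2.+1) (fun i => col_sum (entries M0) i + col_sum (pair_margin (entries M1)) i)%N *
   alt_tail (col_sum (entries M1))).
  rewrite pair_big_dep; apply: eq_big => [[M1 M0]|[M1 M0]]; first by rewrite totmk.
  rewrite totmk => /= tM; congr (_ * _ * _).
  - apply: eq_alt_coef => // i; rewrite -big_split; apply: eq_bigr => j _.
    by rewrite [LHS]ffunE rowE [X in _ = (_ + X)%N]ffunE.
  - apply: eq_alt_coef => // i; rewrite -big_split; apply: eq_bigr => j _.
    by rewrite [LHS]ffunE rowE [X in _ = (_ + X)%N]ffunE.
  - rewrite (alt_coef_tail ledn bl bm); first by apply: eq_alt_tail => j; rewrite colE.
    by rewrite -totC totmk; apply/eqP.
transitivity (\sum_(M1 : {ffun Kt * 'I_r -> 'I_N} | (mass (entries M1) < d.+1)%N)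
   \sum_(e <- words k) word_alt e (row_sum (pair_margin (entries M1))) *
     word_alt e (col_sum (pair_margin (entries M1))) *
     alt_tail (col_sum (entries M1))).
  rewrite [RHS]big_mkcond; apply: eq_bigr => M1 _.
  rewrite -!mulr_suml; case: ltnP => [led|ltd]; last first.
    have -> : alt_tail (col_sum (entries M1)) = 0 by apply: alt_tail_eq0; rewrite -totC.
    by rewrite mulr0.
  congr (_ * _).
  have lt1 : (mass (entries M1) <= n)%N by apply: leq_trans ledn.
  rewrite -(@words_orthogonality k N (n - mass (entries M1))) //.
  - by apply: eq_bigl => M0; lia.
  - lia.
  - rewrite (_ : \sum_i _ = mass (entries M1))%N ?subnKC // totE.
    by rewrite pair_bigA; apply: eq_bigr => -[i j] _; rewrite ffunE.
  - rewrite (_ : \sum_i _ = mass (entries M1))%N ?subnKC // totE.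
    by rewrite /col_sum exchange_big pair_bigA; apply: eq_bigr => -[i j] _; rewrite ffunE.
under [RHS]eq_bigr => a _ do rewrite exchange_big /= big_mkcond /=.
rewrite [RHS]exchange_big [LHS]big_mkcond; apply: eq_bigr => M1 _ /=.
case: ifP => [lt|nlt].
  rewrite (bigD1 (Ordinal lt)) //= eqxx [X in _ = _ + X]big1 ?addr0 // => a na.
  by case: eqP => // e; case/eqP: na; apply: val_inj.
by rewrite big1 // => a _; case: eqP => // e; rewrite e ltn_ord in nlt.
Qed.

End Correction.

(** * Deleting untouched rows *)

Lemma lift_perm_exists n (i j : 'I_n.+1) (w : 'S_n.+1) : w i = j ->
  exists w' : 'S_n, lift_perm i j w' = w.
Proof.
move=> wij; pose f k := odflt k (unlift j (w (lift i k))).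
have fK k : lift j (f k) = w (lift i k).
  rewrite /f; have := neq_lift i k.
  by rewrite -(inj_eq (@perm_inj _ w)) wij => /unlift_some[x -> ->].
have injf : injective f.
  by move=> x y /(congr1 (lift j)); rewrite !fK => /perm_inj /lift_inj.
exists (perm injf); apply/permP => x.
case: (unliftP i x) => [y ->|->]; last by rewrite lift_perm_id.
by rewrite lift_perm_lift permE fK.
Qed.

Lemma lift_perm_inj n (i j : 'I_n.+1) : injective (@lift_perm n i j).
Proof.
move=> s t e; apply/permP => x; apply: (@lift_inj _ j).
by rewrite -!(lift_perm_lift i j) e.
Qed.

Lemma lift_perm_bij n (i j : 'I_n.+1) :
  {on [pred w : 'S_n.+1 | w i == j], bijective (lift_perm i j)}.
Proof.
exists (fun w => odflt 1%g [pick w' : 'S_n | lift_perm i j w' == w]) => [w' _|w].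
  by case: pickP => [w /eqP /lift_perm_inj //|/(_ w')]; rewrite eqxx.
rewrite inE => /eqP /lift_perm_exists [w' <-].
by case: pickP => [w2 /eqP //|/(_ w')]; rewrite eqxx.
Qed.

Lemma perm_lt_stable k m (w : 'S_k) : (forall i : 'I_k, i < m -> w i < m)%N ->
  forall i, (w i < m)%N = (i < m)%N.
Proof.
move=> h i; pose A := [set i : 'I_k | (i < m)%N].
have sub : [set w x | x in A] \subset A.
  by apply/subsetP => _ /imsetP[x xA ->]; move: xA; rewrite !inE; apply: h.
have /eqP eA : [set w x | x in A] == A.
  by rewrite eqEcard sub (card_imset _ (@perm_inj _ w)) leqnn.
have : (w i \in A) = (i \in A) by rewrite -{1}eA (mem_imset _ _ (@perm_inj _ w)).
by rewrite !inE.
Qed.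

Section Deletion.
Variables (k : nat) (u v : seq nat).
Hypotheses (path_uv : path step 0%N (u ++ 0%N :: v)) (size_uv : size (u ++ v) = k).

Lemma path_del : path step 0%N (u ++ v).
Proof.
move: path_uv; rewrite !cat_path => /andP[-> /=].
by case: v => //= x v' /andP[+ ->]; rewrite /step andbT => h; apply: leq_trans h _.
Qed.

Let le_uk : (size u < k.+1)%N.
Proof. by rewrite -size_uv size_cat ltnS leq_addr. Qed.
Let m := Ordinal le_uk.
Local Notation e1 := (u ++ 0%N :: v).
Local Notation e0 := (u ++ v).

Let mem1 : e1 \in words k.+1.
Proof. by rewrite mem_words path_uv -size_uv !size_cat /= addnS eqxx. Qed.
Let mem0 : e0 \in words k.
Proof. by rewrite mem_words path_del size_uv eqxx. Qed.

Let nth_lift (j : 'I_k) : nth 0%N e1 (lift m j) = nth 0%N e0 j.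
Proof.
rewrite /= /bump !nth_cat /=; case: (ltnP j (size u)) => h.
  by rewrite add0n h.
by rewrite add1n ltnNge (leq_trans h) //= subSn.
Qed.

Let shape_m : word_shape e1 m = m.*2.+1.
Proof. by rewrite /word_shape nth_cat ltnn subnn subn0. Qed.

Let shape_lift (j : 'I_k) :
  word_shape e1 (lift m j) = (word_shape e0 j + (size u <= j)%N.*2)%N.
Proof.
rewrite /word_shape nth_lift /= /bump.
have := @nth_word_le e0 j path_del; rewrite size_uv => /(_ (ltn_ord j)).
by case: (leqP (size u) j); lia.
Qed.

Let lt_m (w : 'S_k.+1) (x : 'I_k.+1 -> nat) :
  [forall i, x i + word_shape e1 (w i) == i.*2.+1]%N ->
  (forall i, (w i < m)%N = (i < m)%N).
Proof.
move/forallP => h; apply: perm_lt_stable => i lti.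
rewrite ltnNge; apply/negP => le.
have /eqP := h i; have : (word_shape e1 m <= word_shape e1 (w i))%N.
  by case: (ltngtP m (w i)) le => // [/(word_shape_lt mem1) /ltnW //|/val_inj -> //].
rewrite shape_m; move: lti => /=; lia.
Qed.

Let lt_m0 (w : 'S_k) (x : 'I_k -> nat) :
  [forall i, x i + word_shape e0 (w i) == i.*2.+1]%N ->
  (forall i, (w i < size u)%N = (i < size u)%N).
Proof.
move/forallP => h; apply: perm_lt_stable => i lti.
rewrite ltnNge; apply/negP => le.
have ltk : (size u < k)%N by apply: leq_ltn_trans le (ltn_ord _).
have ge : (word_shape e0 (Ordinal ltk) <= word_shape e0 (w i))%N.
  by case: (ltngtP (size u) (w i)) le => // [lt _|eq _];
    [apply: ltnW (word_shape_lt mem0 _) | rewrite (_ : Ordinal ltk = w i) //; apply: val_inj].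
have : ((size u).*2 <= word_shape e0 (Ordinal ltk))%N.
  rewrite /word_shape /= nth_cat ltnn subnn.
  move: path_uv; rewrite cat_path => /andP[_ /=]; case: (v) => [|y v'] /=; first by lia.
  by rewrite /step; lia.
have /eqP := h i; lia.
Qed.

(** Let m be the place of the deleted letter.  The shape coded by the word has no
    cells in row m, and none of its columns meets rows on both sides of m; for a
    contributing w this means that w fixes m and preserves the set of places below
    m, so that the row can be removed from w and from the shape. *)
Lemma word_alt_del (x : 'I_k.+1 -> nat) :
  word_alt e1 x = (x m == 0%N)%:R * word_alt e0 (fun j => x (lift m j)).
Proof.
have fixm (w : 'S_k.+1) : [forall i, x i + word_shape e1 (w i) == i.*2.+1]%N ->
    (w m == m) && (x m == 0%N).
  move=> hw; have := lt_m hw m; rewrite ltnn => /negbT; rewrite -leqNgt => lem.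
  have /eqP hm := forallP hw m.
  have wm : w m = m.
    apply/val_inj/eqP; rewrite eqn_leq lem andbT leqNgt; apply/negP => lt.
    by have := word_shape_lt mem1 lt; rewrite shape_m; move: hm => /=; lia.
  rewrite wm eqxx /=; move: hm; rewrite wm shape_m => /eqP.
  by rewrite -{2}[m.*2.+1]add0n eqn_add2r.
case: (eqVneq (x m) 0%N) => [x0|nx0]; last first.
  rewrite mul0r /word_alt /alt_coef big_pred0 // => w.
  by apply/negP => /fixm; rewrite (negbTE nx0) andbF.
rewrite mul1r /word_alt /alt_coef.
rewrite (eq_bigl (fun w : 'S_k.+1 => (w m == m) && [forall i, x i + word_shape e1 (w i) == i.*2.+1]%N)); last first.
  by move=> w; apply/idP/andP => [hw|[]//]; case/andP: (fixm w hw).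
rewrite (reindex (lift_perm m m)); last first.
  apply: subon_bij (lift_perm_bij m m) => w; rewrite !inE => /andP[]//.
apply: eq_big => [w|w _]; last by rewrite odd_lift_perm addbb addFb.
rewrite lift_perm_id eqxx /=.
have E (j : 'I_k) : (w j < size u)%N = (j < size u)%N ->
   (x (lift m j) + word_shape e1 (lift_perm m m w (lift m j)) == (lift m j).*2.+1)%N
   = (x (lift m j) + word_shape e0 (w j) == j.*2.+1)%N.
  rewrite lift_perm_lift shape_lift /= /bump => e.
  by move: e; case: (leqP (size u) j); case: (leqP (size u) (w j)) => //; lia.
apply/idP/idP => [hw|hw].
  have st (j : 'I_k) : (w j < size u)%N = (j < size u)%N.
    have := lt_m hw (lift m j); rewrite lift_perm_lift /= /bump.
    by case: (leqP (size u) j); case: (leqP (size u) (w j)) => /=; lia.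
  by apply/forallP => j; rewrite -E // (forallP hw).
(* Conversely, the letter after the deleted zero is at most 1, so that the
   shorter word splits at the same place. *)
have st := @lt_m0 w (fun j => x (lift m j)) hw.
apply/forallP => i; case: (unliftP m i) => [j ->|->].
  by rewrite E; [apply: (forallP hw j)|apply: st].
by rewrite lift_perm_id shape_m x0 add0n.
Qed.

Lemma word_char_del a (t : 'S_a) : word_char k.+1 e1 t = word_char k e0 t.
Proof.
rewrite /word_char; under eq_bigr => f _ do rewrite word_alt_del.
(* Only the colourings that avoid m contribute. *)
pose up (f : {ffun 'I_a -> 'I_k}) : {ffun 'I_a -> 'I_k.+1} := [ffun x => lift m (f x)].
rewrite (bigID (fun f : {ffun 'I_a -> 'I_k.+1} => content f m == 0%N)) /=.
rewrite [X in _ + X]big1 ?addr0; last by move=> f /andP[_ /negbTE ->]; rewrite mul0r.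
have cont0 (f : {ffun 'I_a -> 'I_k.+1}) : (content f m == 0%N) = [forall x, f x != m].
  by rewrite ffunE sum_nat_eq0; apply: eq_forallb => x; rewrite eqb0.
have upE (f : {ffun 'I_a -> 'I_k.+1}) : (content f m == 0%N) = (f \in [set up f' | f' in setT]).
  rewrite cont0; apply/forallP/imsetP => [h|[f' _ ->] x]; last by rewrite ffunE eq_sym neq_lift.
  have ex x : exists y : 'I_k, lift m y == f x.
    have := h x; rewrite eq_sym => /unlift_some[y e _]; by exists y; rewrite e.
  exists [ffun x => xchoose (ex x)] => //; apply/ffunP => x.
  by rewrite !ffunE (eqP (xchooseP (ex x))).
have upinj : injective up.
  move=> f g /ffunP e; apply/ffunP => x.
  by have := e x; rewrite !ffunE => /lift_inj.
under eq_bigl => f do rewrite andbC upE.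
rewrite big_mkcondr big_imset /=; last by move=> ? ? _ _; apply: upinj.
rewrite [RHS]big_mkcond; apply: eq_big => [f|f _]; first by rewrite inE.
have -> : fixedby t (up f) = fixedby t f.
  by apply: eq_forallb => x; rewrite !ffunE (inj_eq lift_inj).
case: ifP => // _.
have -> : content (up f) m == 0%N by rewrite upE imset_f ?inE.
rewrite mul1r; apply: eq_alt_coef => // j; rewrite !ffunE; apply: eq_bigr => x _.
by rewrite ffunE (inj_eq lift_inj).
Qed.

End Deletion.

Definition strip (e : seq nat) : seq nat := [seq x <- e | x != 0%N].

Lemma strip_cat_zero u v : strip (u ++ 0%N :: v) = strip (u ++ v).
Proof. by rewrite /strip !filter_cat. Qed.

(** This is what makes the Kronecker coefficient polynomial: rows of the skew shape
    without cells do not matter. *)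
Lemma word_char_strip e a (t : 'S_a) : path step 0%N e ->
  word_char (size e) e t = word_char (size (strip e)) (strip e) t.
Proof.
move: {2}(size e) (leqnn (size e)) => n; elim: n e => [|n IH] e.
  by rewrite leqn0 size_eq0 => /eqP ->.
move=> len pe; case: (boolP (0%N \in e)) => [/splitPr e0|n0]; last first.
  suff -> : strip e = e by [].
  by apply/all_filterP/allP => x xe; apply: contraNneq n0 => <-.
case: e0 => u v in len pe *; rewrite strip_cat_zero.
have -> : size (u ++ 0%N :: v) = (size (u ++ v)).+1 by rewrite !size_cat addnS.
rewrite word_char_del // [LHS]IH ?(path_del pe) //.
by move: len; rewrite !size_cat /= addnS ltnS.
Qed.

Lemma path_strip e : path step 0%N e -> path step 0%N (strip e).
Proof.
move: {2}(size e) (leqnn (size e)) => n; elim: n e => [|n IH] e.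
  by rewrite leqn0 size_eq0 => /eqP ->.
move=> len pe; case: (boolP (0%N \in e)) => [/splitPr e0|n0]; last first.
  suff -> : strip e = e by [].
  by apply/all_filterP/allP => x xe; apply: contraNneq n0 => <-.
case: e0 => u v in len pe *; rewrite strip_cat_zero.
apply: IH (path_del pe).
by move: len; rewrite !size_cat /= addnS ltnS.
Qed.

(** Adding up the conditions in [alt_coef] over all rows gives the size of the
    skew shape. *)
Lemma word_char_neq a k e (t : 'S_a) : e \in words k -> sumn e != a -> word_char k e t = 0.
Proof.
rewrite mem_words => /andP[/eqP se pe] ne; apply: big1 => f _.
rewrite /word_alt /alt_coef big_pred0 // => w; apply/negP => /forallP h.
case/eqP: ne; have := mass_content f; rewrite card_ord => <-.
have sb : (\sum_(i < k) word_shape e (w i) + sumn e = \sum_(i < k) i.*2.+1)%N.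
  rewrite [in RHS](reindex_inj (@perm_inj _ w)).
  have -> : sumn e = (\sum_(i < k) nth 0%N e (w i))%N.
    rewrite sumnE (big_nth 0%N) se big_mkord.
    exact: (reindex_inj (@perm_inj _ w)).
  rewrite -big_split; apply: eq_bigr => i _ /=; rewrite /word_shape subnK //.
  by have := nth_word_le pe; rewrite se => /(_ _ (ltn_ord (w i))); lia.
have : (mass (content f) + \sum_(i < k) word_shape e (w i) = \sum_(i < k) i.*2.+1)%N.
  by rewrite -big_split; apply: eq_bigr => i _; apply/eqP/h.
by rewrite -sb addnC => /addnI.
Qed.

(** * Counting words *)

Definition strip_count k z : nat := (\sum_(e <- words k) (strip e == z))%N.

Lemma sum_words k (F : seq nat -> nat) :
  (\sum_(e <- words k.+1) F e
   = \sum_(e <- words k) \sum_(x <- iota 0 (last 0 e).+2) F (rcons e x))%N.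
Proof. by rewrite big_allpairs_dep. Qed.

Lemma strip_rcons e x : strip (rcons e x) = if x == 0%N then strip e else rcons (strip e) x.
Proof. by rewrite /strip filter_rcons; case: eqP. Qed.

(** The letter 0 can be appended to every word. *)
Lemma last_word_zero k z :
  (\sum_(e <- words k.+1) ((strip e == z) && (last 0 e == 0)) = strip_count k z)%N.
Proof.
rewrite sum_words; apply: eq_bigr => e _.
rewrite /= big_cons big1_seq ?addn0.
  by rewrite strip_rcons last_rcons eqxx andbT.
move=> x /andP[_]; rewrite in_cons mem_iota last_rcons => xn0.
by rewrite [x == 0%N]gtn_eqF ?andbF //; case/orP: xn0 => [/eqP -> //|/andP[] /ltnW].
Qed.

Lemma strip_count_nil k : strip_count k [::] = 1%N.
Proof.
elim: k => [|k IH]; first by rewrite /strip_count big_seq1.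
rewrite -[RHS]IH /strip_count sum_words; apply: eq_bigr => e _.
rewrite /= big_cons strip_rcons /= big1_seq ?addn0 // => x /andP[_].
rewrite in_cons mem_iota strip_rcons => xn0.
rewrite [x == 0%N]gtn_eqF; last by case/orP: xn0 => [/eqP -> //|/andP[] /ltnW].
by case: (strip e).
Qed.

Lemma strip_count_rcons k z y : (0 < y)%N ->
  strip_count k.+1 (rcons z y)
  = (strip_count k (rcons z y) + \sum_(e <- words k) ((strip e == z) && (y < (last 0 e).+2)))%N.
Proof.
move=> y0; rewrite /strip_count sum_words -big_split; apply: eq_bigr => e _ /=.
rewrite big_cons strip_rcons /=; congr (_ + _)%N.
rewrite -[1%N :: iota 2 _]/(iota 1 (last 0%N e).+1).
case: (boolP (y < _)%N) => lty.
  rewrite andbT (bigD1_seq y) ?iota_uniq ?mem_iota ?y0 //.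
  rewrite strip_rcons gtn_eqF // eqseq_rcons eqxx andbT big1_seq; [by rewrite /= addn0 | move=> x].
  rewrite mem_iota => /and3P[nxy x0 _].
  by rewrite strip_rcons gtn_eqF // eqseq_rcons (negbTE nxy) andbF.
rewrite andbF big1_seq // => x; rewrite mem_iota => /= /andP[x0 ltx].
rewrite strip_rcons gtn_eqF // eqseq_rcons [x == y]ltn_eqF ?andbF //.
by apply: leq_trans ltx _; rewrite leqNgt.
Qed.

(** In a word without zeros, each letter 1 begins a new connected component of the
    skew shape. *)
Definition ones (z : seq nat) : nat := count_mem 1%N z.

Lemma ones_gt0 z : path step 0%N z -> 0%N \notin z -> z != [::] -> (0 < ones z)%N.
Proof.
by case: z => // -[|[|x]] z //=; rewrite /step.
Qed.

Lemma ones_le z : (ones z <= size z)%N.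
Proof. exact: count_size. Qed.

(** Zeros can be inserted into [z] before each letter 1 and at the end, so there
    are [ones z + 1] places for them.  The induction removes the last letter of the
    longer word: either it is an inserted zero, or it is the last letter y of [z];
    if y > 1, the letter before it is not an inserted zero. *)
Lemma strip_countE k z : path step 0%N z -> 0%N \notin z ->
  strip_count k z = 'C(k + ones z - size z, ones z).
Proof.
elim/ltn_ind: k z => k IH z.
case: k IH => [|k] IH; case/lastP: z => [|z y] pz nz.
- by rewrite strip_count_nil bin0.
- rewrite /strip_count big_seq1 /= [[::] == _](_ : _ = false); last by case: (z).
  have := ones_le (rcons z y); have : (0 < ones (rcons z y))%N.
    by apply: ones_gt0 => //; rewrite -size_eq0 size_rcons.
  by move=> h1 h2; rewrite bin_small //; lia.
- by rewrite strip_count_nil bin0.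
have y0 : (0 < y)%N.
  by rewrite lt0n; apply: contraNneq nz => ->; rewrite mem_rcons inE eqxx.
have nz' : 0%N \notin z by apply: contra nz; rewrite mem_rcons inE orbC => ->.
move: (pz); rewrite rcons_path => /andP[pz' sty].
rewrite strip_count_rcons // IH //.
have onesE : ones (rcons z y) = (ones z + (y == 1))%N.
  by rewrite /ones -cats1 count_cat /= addn0.
have le' := ones_le z.
case: (eqVneq y 1%N) onesE => [y1|ny1] onesE.
  have -> : (\sum_(e <- words k) ((strip e == z) && (y < (last 0 e).+2)) = strip_count k z)%N.
    by apply: eq_bigr => e _; rewrite y1 andbT.
  rewrite IH // onesE size_rcons addn1 !addnS subSS addSn subSS.
  case: (leqP (size z) (k + ones z)) => lez; first by rewrite subSn // binS.
  have z0 : z != [::] by apply: contraTneq lez => ->.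
  have one0 := ones_gt0 pz' nz' z0.
  by rewrite !bin_small //; lia.
rewrite addn0 in onesE; rewrite onesE size_rcons.
have znil : z != [::].
  by apply/eqP => z0; move: sty; rewrite z0 /step /=; lia.
have one0 := ones_gt0 pz' nz' znil.
have lastE e : strip e = z -> (y < (last 0 e).+2)%N = (last 0%N e != 0%N).
  move=> ez; case/lastP: e ez => [|e x] ez; first by case: (z) znil ez.
  rewrite last_rcons; move: ez; rewrite strip_rcons; case: eqP => [-> _|nx ez] /=.
    by lia.
  by move: sty; rewrite -ez last_rcons /step.
have split : (\sum_(e <- words k) ((strip e == z) && (y < (last 0 e).+2))
   + \sum_(e <- words k) ((strip e == z) && (last 0 e == 0)) = strip_count k z)%N.
  rewrite -big_split; apply: eq_bigr => e _ /=.
  by case: eqP => //= /lastE ->; case: eqP.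
(* The zeros that would precede y > 1 are counted by the words ending in 0. *)
case: k IH split => [|k] IH split.
  have : (\sum_(e <- words 0) ((strip e == z) && (y < (last 0 e).+2)) <= strip_count 0 z)%N.
    by rewrite -split leq_addr.
  rewrite IH // bin_small; last by lia.
  rewrite leqn0 => /eqP ->; rewrite !bin_small //; lia.
rewrite last_word_zero !IH // in split.
have e1 : (k.+1 + ones z - (size z).+1 = k + ones z - size z)%N by lia.
have e2 : (k.+2 + ones z - (size z).+1 = k.+1 + ones z - size z)%N by lia.
by rewrite e1 e2 addnC.
Qed.

(** * The Kronecker polynomial *)

(** The polynomial in k that agrees with ['C(k + j - m, j)] where the subtraction
    is not truncated. *)
Definition shifted_bin (m j : nat) : {poly rat} :=
  (j`!%:R)^-1 *: \prod_(0 <= i < j) ('X - (m%:R + i%:R - j%:R)%:P).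

Lemma ffact_natr n j : (n ^_ j)%:R = \prod_(i < j) (n%:R - i%:R) :> rat.
Proof.
elim: j => [|j IH]; first by rewrite big_ord0.
rewrite ffactnSr natrM big_ord_recr /= IH.
case: (leqP j n) => lejn; first by rewrite natrB.
by rewrite -IH ffact_small ?mul0r.
Qed.

Lemma shifted_binE m j k : (m <= k + j)%N ->
  (shifted_bin m j).[k%:R] = ('C(k + j - m, j))%:R.
Proof.
move=> lem; rewrite hornerZ horner_prod big_mkord.
have -> : \prod_(i < j) ('X - (m%:R + i%:R - j%:R)%:P).[k%:R] = ((k + j - m) ^_ j)%:R :> rat.
  rewrite ffact_natr; apply: eq_bigr => i _.
  by rewrite hornerXsubC natrB // natrD; ring.
by rewrite -bin_ffact natrM mulrCA mulVf ?mulr1 // pnatr_eq0 -lt0n fact_gt0.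
Qed.

Lemma size_shifted_bin m j : size (shifted_bin m j) = j.+1.
Proof.
rewrite size_scale ?invr_eq0 ?pnatr_eq0 -?lt0n ?fact_gt0 //.
by rewrite size_prod_XsubC size_iota subn0.
Qed.

Lemma lead_shifted_bin m j : (shifted_bin m j)`_j = (j`!%:R)^-1.
Proof.
have := lead_coefE (shifted_bin m j); rewrite size_shifted_bin /= => <-.
by rewrite lead_coefZ lead_coef_prod_XsubC mulr1.
Qed.

Section Polynomial.
Variables (r d : nat) (c : 'I_r -> nat).

(** The contribution of each word of mass [a] from which [z] arises by deleting the
    zeros. *)
Definition block a z : rat :=
  (a`!%:R)^-1 * (\sum_(t : 'S_a) word_char (size z) z t ^+ 2 * tail_char c t)%:~R.

Lemma block_sum_block N a k e : (a < N)%N -> e \in words k ->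
  (block_sum c N a k e)%:~R = if sumn e == a then block a (strip e) else 0.
Proof.
move=> ltaN we; have := block_sumE c k e ltaN => /(congr1 (fun z : int => z%:~R : rat)).
rewrite rmorphM /= natz -pmulrn => E.
have a0 : a`!%:R != 0 :> rat by rewrite pnatr_eq0 -lt0n fact_gt0.
apply: (mulfI a0); rewrite E; case: eqP => [sa|/eqP sa]; last first.
  rewrite mulr0 big1 // => t _; first by rewrite (word_char_neq _ we sa) expr2 mul0r.
rewrite mulrA mulfV // mul1r; congr (_%:~R); apply: eq_bigr => t _.
move: we; rewrite mem_words => /andP[/eqP <- pe].
by rewrite (word_char_strip t pe).
Qed.

Definition short_words a : seq (seq nat) :=
  [seq z <- flatten [seq words W | W <- iota 0 a.+1] | (0%N \notin z) && (sumn z == a)].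

Definition kron_poly : {poly rat} :=
  \sum_(a < d.+1) \sum_(z <- short_words a)
     block a z *: shifted_bin (size z) (ones z).

Lemma uniq_flatten_words s : uniq s -> uniq (flatten [seq words W | W <- s]).
Proof.
elim: s => //= W s IH /andP[nW us]; rewrite cat_uniq uniq_words IH // andbT /=.
apply/hasPn => e /flattenP[_ /mapP[V Vs ->] eV]; apply/negP => eW.
move: eV eW; rewrite !mem_words => /andP[/eqP sV _] /andP[/eqP sW _].
by move: nW; rewrite -sW sV Vs.
Qed.

Lemma mem_short_words a z :
  (z \in short_words a) = [&& path step 0%N z, 0%N \notin z & sumn z == a].
Proof.
rewrite mem_filter andbC; apply: andb_id2r => /andP[nz /eqP sz].
apply/flattenP/idP => [[_ /mapP[W _ ->]]|pz]; first by rewrite mem_words => /andP[].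
exists (words (size z)); last by rewrite mem_words eqxx.
apply/map_f; rewrite mem_iota /= add0n ltnS -sz.
elim: (z) nz => //= x s IH; rewrite inE negb_or => /andP[x0 /IH].
by move: x0; lia.
Qed.

Lemma strip_props e : (0%N \notin strip e) && (sumn (strip e) == sumn e).
Proof.
rewrite mem_filter eqxx /= /strip; elim: e => //= x e /eqP IH.
by case: (eqVneq x 0%N) => [->|_] /=; rewrite IH.
Qed.

Lemma sum_block_words a k :
  \sum_(e <- words k) (if sumn e == a then block a (strip e) else 0)
  = \sum_(z <- short_words a) block a z * (strip_count k z)%:R.
Proof.
have us : uniq (short_words a) by rewrite filter_uniq // uniq_flatten_words ?iota_uniq.
rewrite /strip_count; under [RHS]eq_bigr => z _ do rewrite natr_sum mulr_sumr.
rewrite [RHS]exchange_big big_seq [RHS]big_seq; apply: eq_bigr => e /=.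
rewrite mem_words => /andP[_ pe]; have /andP[nz /eqP ss] := strip_props e.
case: eqP => sa.
  rewrite (bigD1_seq (strip e)) ?mem_short_words ?path_strip ?nz ?ss ?sa //=.
  rewrite eqxx mulr1 big1 ?addr0 // => z; rewrite eq_sym => /negbTE ->.
  by rewrite mulr0.
rewrite big1_seq // => z /=; rewrite mem_short_words => /and3P[_ _ /eqP sz].
case: eqP => [ez|_]; last by rewrite mulr0.
by case: sa; rewrite -ss ez.
Qed.

Lemma size_short a z : z \in short_words a -> (size z <= a)%N.
Proof.
rewrite mem_short_words => /and3P[_ nz /eqP <-].
elim: z nz => //= x s IH; rewrite inE negb_or eq_sym -lt0n => /andP[x0 /IH]; lia.
Qed.

(** A word in [short_words a] has at most [a <= d] letters and, if it is not empty,
    begins with the letter 1; so [d <= k.+1] suffices to apply [shifted_binE]. *)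
Lemma kron_polyE N k : (d < N)%N -> (d <= k.+1)%N ->
  (\sum_(a < d.+1) \sum_(e <- words k) block_sum c N a k e)%:~R = kron_poly.[k%:R].
Proof.
move=> ltdN ledk; rewrite raddf_sum horner_sum; apply: eq_bigr => a _ /=.
rewrite raddf_sum horner_sum /=; have lead : (a <= d)%N by rewrite -ltnS.
transitivity (\sum_(e <- words k) (if sumn e == a then block a (strip e) else 0)).
  rewrite big_seq [RHS]big_seq; apply: eq_bigr => e we.
  by rewrite block_sum_block // (leq_ltn_trans lead).
rewrite sum_block_words big_seq [RHS]big_seq; apply: eq_bigr => z zs.
have := size_short zs; move: zs; rewrite mem_short_words => /and3P[pz nz _] sz.
rewrite strip_countE // hornerZ shifted_binE //.
case: (eqVneq z [::]) => [->//|z0]; have o1 := ones_gt0 pz nz z0.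
by rewrite (leq_trans sz) // (leq_trans lead) // (leq_trans ledk) // -addn1 leq_add2l.
Qed.

Lemma ones_all a z : z \in short_words a -> ones z = a -> z = nseq a 1%N.
Proof.
move=> zs oz; have sz := size_short zs; have := ones_le z; rewrite oz => lez.
have size_z : size z = a by apply/eqP; rewrite eqn_leq sz.
have : all (pred1 1%N) z by rewrite all_count size_z -oz.
by move/all_pred1P; rewrite size_z.
Qed.

Lemma perm_le1 k (w : 'S_k) : (forall i, w i <= i)%N -> w = 1%g.
Proof.
move=> h; have s : (\sum_(i < k) w i = \sum_(i < k) i)%N by rewrite [RHS](reindex_inj (@perm_inj _ w)).
apply/permP => i; rewrite perm1; apply/val_inj/eqP; rewrite /= eqn_leq h leqNgt; apply/negP => lt.
have : (\sum_(i < k) w i < \sum_(i < k) i)%N.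
  rewrite (bigD1 i) //= [X in (_ < X)%N](bigD1 i) //= -addSn leq_add //.
  by apply: leq_sum.
by rewrite s ltnn.
Qed.

Lemma word_alt_ones k (x : 'I_k -> nat) :
  word_alt (nseq k 1%N) x = [forall i, x i == 1%N]%:R.
Proof.
have sh (i : 'I_k) : word_shape (nseq k 1%N) i = i.*2.
  by rewrite /word_shape nth_nseq ltn_ord subn1.
rewrite /word_alt /alt_coef; case: forallP => h.
  rewrite (big_pred1 1%g) ?odd_perm1 // => w.
  apply/forallP/eqP => [hw|-> i]; last by rewrite perm1 sh (eqP (h i)).
  by apply: perm_le1 => i; have := hw i; rewrite sh (eqP (h i)); lia.
rewrite big_pred0 // => w; apply/negP => /forallP hw.
have w1 : w = 1%g by apply: perm_le1 => i; have := hw i; rewrite sh; lia.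
by apply: h => i; have := hw i; rewrite sh w1 perm1; lia.
Qed.

(** The skew shape consists of disconnected cells, and its character is the regular
    one. *)
Lemma word_char_ones a (t : 'S_a) :
  word_char a (nseq a 1%N) t = (t == 1%g)%:R * a`!%:R.
Proof.
have injc (f : {ffun 'I_a -> 'I_a}) : [forall i, content f i == 1%N] -> injective f.
  move=> /forallP h x y e; apply/eqP; apply: contraT => nxy.
  have := h (f x); rewrite ffunE (bigD1 x) //= eqxx (bigD1 y) //= 1?eq_sym //.
  by rewrite e eqxx.
have fixE (f : {ffun 'I_a -> 'I_a}) (s : 'S_a) : [forall i, content f i == 1%N] ->
    fixedby s f = (s == 1%g).
  move=> /injc injf; apply/forallP/eqP => [h|-> x]; last by rewrite perm1.
  by apply/permP => x; rewrite perm1; apply: injf; apply/eqP.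
rewrite /word_char; under eq_bigr => f _ do rewrite word_alt_ones.
have E (f : {ffun 'I_a -> 'I_a}) : [forall i, content f i == 1%N] = (content f == [ffun=> 1%N]).
  apply/forallP/eqP => [h|-> i]; last by rewrite ffunE.
  by apply/ffunP => i; rewrite [RHS]ffunE; apply/eqP.
have tot : mass [ffun _ : 'I_a => 1%N] = a.
  by rewrite /mass; under eq_bigr => i _ do rewrite ffunE; rewrite sum1_card card_ord.
rewrite -(orbit_content tot) natr_sum mulr_sumr big_mkcond [RHS]big_mkcond.
apply: eq_bigr => f _; rewrite -E; case: (boolP [forall i, _]) => cf; last by rewrite if_same.
rewrite fixE // (_ : #|_| = 1%N); first by case: eqP; rewrite ?mulr1 ?mul0r.
rewrite (_ : [set s | fixedby s f] = [set 1%g]) ?cards1 //.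
by apply/setP => s; rewrite !inE fixE.
Qed.

Lemma block_ones : block d (nseq d 1%N) = d`!%:R * (tail_char c (1%g : 'S_d))%:~R.
Proof.
have a0 : d`!%:R != 0 :> rat by rewrite pnatr_eq0 -lt0n fact_gt0.
rewrite /block size_nseq (bigD1 1%g) //= big1 ?addr0.
  by rewrite word_char_ones eqxx mul1r rmorphM rmorphXn /= natz -pmulrn expr2 -mulrA mulKf.
by move=> t nt; rewrite word_char_ones (negbTE nt) mul0r expr2 mul0r mul0r.
Qed.

Lemma size_kron_poly : (size kron_poly <= d.+1)%N.
Proof.
apply: (big_ind (fun p : {poly rat} => (size p <= d.+1)%N)); first by rewrite size_poly0.
  by move=> p q hp hq; rewrite (leq_trans (size_polyD _ _)) // geq_max hp.
move=> a _; rewrite big_seq; apply: (big_ind (fun p : {poly rat} => (size p <= d.+1)%N)).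
- by rewrite size_poly0.
- by move=> p q hp hq; rewrite (leq_trans (size_polyD _ _)) // geq_max hp.
move=> z zs; apply: leq_trans (size_scale_leq _ _) _; rewrite size_shifted_bin ltnS.
by apply: leq_trans (ones_le z) (leq_trans (size_short zs) _); rewrite -ltnS.
Qed.

Hypothesis sum_c : (\sum_j c j = d + 'C(r, 2))%N.

(** If the whole mass [d] is used by the rows of nu, the permutation u must fix the
    index of the long row. *)
Lemma alt_tail_coef m : (\sum_j m j = d)%N -> alt_tail c m = alt_coef delta c m.
Proof.
move=> sm; rewrite /alt_tail.
rewrite (eq_bigl (fun u : 'S_r.+1 => (u ord_max == ord_max) &&
  [forall j, m j + u (lift ord_max j) == c j]%N)); last first.
  move=> u; rewrite andbC andb_idr // => h; have := alt_tail_mass sum_c h.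
  by rewrite sm => /addnI e; apply/eqP/val_inj; rewrite /= -e.
rewrite (reindex (lift_perm ord_max ord_max)); last first.
  by apply: subon_bij (lift_perm_bij _ _) => w; rewrite !inE => /andP[].
apply: eq_big => [w|w _]; last by rewrite odd_lift_perm addbb addFb.
rewrite lift_perm_id eqxx /=; apply: eq_forallb => j.
by rewrite lift_perm_lift /= /bump leqNgt ltn_ord.
Qed.

Lemma tail_char_frob (t : 'S_d) : tail_char c t = frob_char c t.
Proof.
apply: eq_bigr => f _; apply: alt_tail_coef.
by have := mass_content f; rewrite card_ord.
Qed.

(** Words with fewer than [d] letters 1 contribute polynomials of smaller degree. *)
Lemma kron_poly_coef : kron_poly`_d = (frob_char c (1%g : 'S_d))%:~R.
Proof.
have a0 : d`!%:R != 0 :> rat by rewrite pnatr_eq0 -lt0n fact_gt0.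
rewrite coef_sum (bigD1 ord_max) //= [X in _ + X]big1 ?addr0; last first.
  move=> a na; rewrite coef_sum big1_seq // => z /= zs.
  rewrite coefZ nth_default ?mulr0 // size_shifted_bin.
  have lta : (a < d)%N by rewrite ltn_neqAle -ltnS ltn_ord andbT; apply: contra na => /eqP e; apply/eqP/val_inj.
  by apply: leq_ltn_trans (ones_le z) (leq_ltn_trans (size_short zs) lta).
have us : uniq (short_words d) by rewrite filter_uniq // uniq_flatten_words ?iota_uniq.
have zs1 : nseq d 1%N \in short_words d.
  rewrite mem_short_words sumn_nseq mul1n eqxx andbT mem_nseq andbF /= andbT.
  by apply/(pathP 0%N) => i; rewrite size_nseq => lti; rewrite /step nth_nseq lti.
rewrite coef_sum (bigD1_seq (nseq d 1%N)) //= big1_seq ?addr0; last first.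
  move=> z /andP[nz zs]; rewrite coefZ nth_default ?mulr0 // size_shifted_bin ltn_neqAle.
  rewrite (leq_trans (ones_le z) (size_short zs)) andbT.
  by apply: contra nz => /eqP oz; apply/eqP/(ones_all zs).
rewrite coefZ size_nseq (_ : ones _ = d); last by rewrite /ones count_nseq /= mul1n.
by rewrite lead_shifted_bin block_ones tail_char_frob mulrAC mulfV ?mul1r.
Qed.

End Polynomial.

(** * Standard Young tableaux *)

Section Ways.
Variable k : nat.
Implicit Types c : 'I_k -> nat.

(** The value of [frob_char] at the identity. *)
Definition frob_dim d c : int := \sum_(f : {ffun 'I_d -> 'I_k}) alt_coef delta c (content f).

Lemma frob1 d c : frob_char c (1%g : 'S_d) = frob_dim d c.
Proof.
by apply: eq_bigl => f; apply/forallP => x; rewrite perm1.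
Qed.

Lemma frob_dim_eq d c c' : c =1 c' -> frob_dim d c = frob_dim d c'.
Proof. by move=> e; apply: eq_bigr => f _; apply: eq_alt_coef. Qed.

Lemma frob_dim_recr d c :
  frob_dim d.+1 c = \sum_i (0 < c i)%N%:R * frob_dim d (fun j => c j - (j == i))%N.
Proof.
pose mk (p : 'I_k * {ffun 'I_d -> 'I_k}) : {ffun 'I_d.+1 -> 'I_k} :=
  [ffun x => if unlift ord_max x is Some y then p.2 y else p.1].
pose sp (f : {ffun 'I_d.+1 -> 'I_k}) : 'I_k * {ffun 'I_d -> 'I_k} :=
  (f ord_max, [ffun y => f (lift ord_max y)]).
have mkK : cancel mk sp.
  case=> z g; congr (_, _); first by rewrite ffunE unlift_none.
  by apply/ffunP => y; rewrite !ffunE liftK.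
have spK : cancel sp mk.
  move=> f; apply/ffunP => x; rewrite ffunE.
  by case: (unliftP ord_max x) => [y ->|->] //=; rewrite ffunE.
rewrite /frob_dim (reindex mk); last by apply: onW_bij; exists sp.
rewrite -(pair_bigA _ (fun i g => alt_coef delta c (content (mk (i, g))))) /=.
apply: eq_bigr => i _; rewrite mulr_sumr; apply: eq_bigr => g _.
have -> : (0 < c i)%N = [forall j, (j == i) <= c j]%N.
  by apply/idP/forallP => [c0 j|/(_ i)]; [case: eqP => [->|]|rewrite eqxx].
rewrite -(alt_shift delta c (content g) (fun j => (j == i : nat))).
apply: eq_alt_coef => // j; rewrite !ffunE big_ord_recr /= ffunE unlift_none eq_sym; congr (_ + _)%N.
apply: eq_bigr => y _; rewrite ffunE.
have -> : widen_ord (leqnSn d) y = lift ord_max y.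
  by apply: val_inj; rewrite /= /bump leqNgt ltn_ord.
by rewrite liftK.
Qed.

(** Exchanging two colours with equal exponents changes the sign of every term. *)
Lemma frob_dim_eq0 d c (i j : 'I_k) : i != j -> c i = c j -> frob_dim d c = 0.
Proof.
move=> nij eij; pose t := tperm i j.
have ct x : c (t x) = c x by case: (tpermP i j x) => [->|->|].
apply: int_eq_opp0; rewrite {1}/frob_dim.
rewrite (reindex (fun f : {ffun 'I_d -> 'I_k} => [ffun x => t (f x)])); last first.
  by apply: onW_bij; exists (fun f : {ffun 'I_d -> 'I_k} => [ffun x => t (f x)]) => f;
    apply/ffunP => x; rewrite !ffunE tpermK.
rewrite /frob_dim -sumrN; apply: eq_bigr => f _ /=.
rewrite /alt_coef (reindex_inj (mulgI t)) -sumrN /=; apply: eq_big => [w|w _]; last first.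
  by rewrite odd_permM odd_tperm nij addTb signrN.
have cE x : content [ffun y => t (f y)] x = content f (t x).
  by rewrite !ffunE; apply: eq_bigr => y _; rewrite ffunE (can2_eq (tpermK i j) (tpermK i j)).
apply/forallP/forallP => h x.
  by have := h (t x); rewrite cE permM tpermK ct.
by have := h (t x); rewrite cE permM ct.
Qed.

End Ways.

Lemma sumn_take (s : seq nat) r : sumn (take r s) = (\sum_(t < r) nth 0 s t)%N.
Proof.
elim: r s => [|r IH] s; first by rewrite take0 big_ord0.
case: s => [|x s]; first by rewrite big1 // => i _; rewrite nth_nil.
by rewrite /= IH big_ord_recl.
Qed.

Section Corner.
Variables (d : nat) (nu : seq nat).
Hypotheses (nu_sorted : sorted geq nu) (nu_size : sumn nu = d.+1).

Local Notation row_ := (reshape_index nu).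
Local Notation col_ := (reshape_offset nu).
Local Notation part r := (nth 0%N nu r).

Definition remove_cell i : seq nat := mkseq (fun r => part r - (r == i))%N (size nu).

Definition corner i : bool := (part i.+1 < part i)%N.

Lemma nth_remove i r : nth 0%N (remove_cell i) r = (part r - (r == i))%N.
Proof.
case: (ltnP r (size nu)) => h; first by rewrite nth_mkseq.
by rewrite !nth_default ?size_mkseq.
Qed.

Lemma remove_sorted i : corner i -> sorted geq (remove_cell i).
Proof.
clear nu_size; move=> ci; apply/(sortedP 0%N) => r _; rewrite !nth_remove /=.
have := part_anti nu_sorted (leqnSn r); move: ci; rewrite /corner.
by case: (eqVneq r i) => [->|]; case: eqP; lia.
Qed.

Lemma corner_lt i : corner i -> (i < size nu)%N.
Proof. by move=> ci; rewrite ltnNge; apply/negP => h; move: ci; rewrite /corner (nth_default _ h). Qed.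

Lemma remove_size i : corner i -> sumn (remove_cell i) = d.
Proof.
clear nu_sorted; have S s : (sumn s = \sum_(r < size s) nth 0 s r)%N.
  by rewrite sumnE (big_nth 0%N) big_mkord.
move=> ci; have e := nu_size; rewrite S in e.
pose i0 := Ordinal (corner_lt ci).
have D (F : 'I_(size nu) -> nat) : (\sum_r F r = F i0 + \sum_(r | r != i0) F r)%N.
  by rewrite (bigD1 i0).
rewrite S size_mkseq; under eq_bigr => r _ do rewrite nth_remove.
rewrite D /= eqxx; rewrite D in e.
rewrite (eq_bigr (fun r : 'I_(size nu) => part r)); last first.
  by move=> r nr; rewrite [r == i :> nat](_ : _ = false) ?subn0 //; apply: contraNF nr => /eqP e1; apply/eqP/val_inj.
have := ci; move: e => /=; rewrite /corner.
by move: (nth 0%N nu i) (\sum_(_ < _ | _) _)%N => A B; lia.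
Qed.

Definition corner_cell (x : nat) : bool :=
  (part (row_ x) == (col_ x).+1) && (part (row_ x).+1 <= col_ x)%N.

Lemma corner_cell_row x : corner_cell x -> corner (row_ x).
Proof. by case/andP => /eqP e l; rewrite /corner e ltnS. Qed.

(** Cells are numbered row by row, so that deleting the cell [x] lowers the numbers
    of the later cells by one; [lift x] recovers the old numbers. *)
Lemma lift_cell (x : 'I_d.+1) (y : 'I_d) : corner_cell x ->
  row_ (lift x y) = reshape_index (remove_cell (row_ x)) y /\
  col_ (lift x y) = reshape_offset (remove_cell (row_ x)) y.
Proof.
move=> cx; have ci := corner_cell_row cx; set i := row_ x in ci *.
set nu' := remove_cell i.
have sy : sumn nu' = d := remove_size ci.
set r := reshape_index nu' y; set c := reshape_offset nu' y.
have ltc : (c < nth 0%N nu' r)%N by apply: reshape_offsetP; rewrite sy.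
have ey : flatten_index nu' r c = y by apply: reshape_indexK.
have ex : flatten_index nu i (col_ x) = x by apply: reshape_indexK.
have ltc' : (c < part r)%N by apply: leq_trans ltc _; rewrite nth_remove leq_subr.
have S0 (q : nat) : (\sum_(t < q) nth 0 nu' t + (i < q) = \sum_(t < q) part t)%N.
  elim: q => [|q IH]; first by rewrite !big_ord0.
  rewrite !big_ord_recr /= -IH nth_remove ltnS.
  have := ci; rewrite /corner; move: (\sum_(_ < _) _)%N => A.
  by case: (ltngtP i q) => [||->]; lia.
have mono a b : (a <= b)%N -> (\sum_(t < a) part t <= \sum_(t < b) part t)%N.
  move=> ab; rewrite -(subnKC ab) big_split_ord /= leq_addr //.
suff -> : nat_of_ord (lift x y) = flatten_index nu r c.
  by rewrite flatten_indexKl ?flatten_indexKr.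
rewrite /= /bump -{1 2}ey -{1}ex /flatten_index !sumn_take -(S0 r).
have e1 : part i = (col_ x).+1 by case/andP: cx => /eqP.
case: (ltngtP r i) => [lt|lt|e].
- have := mono _ _ lt; rewrite big_ord_recr /= -(S0 r).
  move: (\sum_(t < i) _)%N (\sum_(t < r) _)%N => A B.
  by case: leqP; lia.
- have := mono _ _ lt; rewrite big_ord_recr /= -(S0 r) e1.
  move: (\sum_(t < i) _)%N (\sum_(t < r) _)%N => A B.
  by case: leqP; lia.
move: ltc; rewrite e nth_remove eqxx e1 -(S0 i) ltnn addn0.
by move: (\sum_(t < i) _)%N => A; case: leqP; lia.
Qed.

(** A cell to the right of [x] or below it would have to contain a larger entry. *)
Lemma syt_corner (T : 'S_d.+1) (x : 'I_d.+1) : is_syt nu T -> T x = ord_max ->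
  corner_cell x.
Proof.
move=> /forallP sT Tx.
have no (y : 'I_d.+1) : ~~ (T x < T y)%N by rewrite Tx -leqNgt -ltnS ltn_ord.
apply/andP; split.
  rewrite eqn_leq (col_lt nu_size x) andbT leqNgt; apply/negP => lt.
  have [y [ry cy]] := cell_exists nu_size lt.
  have /forallP/(_ y)/andP[+ _] := sT x.
  by rewrite /same_row ry cy eqxx ltnSn (negbTE (no y)).
rewrite leqNgt; apply/negP => lt.
have [y [ry cy]] := cell_exists nu_size lt.
have /forallP/(_ y)/andP[_ +] := sT x.
by rewrite /same_col ry cy eqxx ltnSn (negbTE (no y)).
Qed.

(** Below or to the right of a corner there is no cell, so the largest entry placed
    there imposes no condition on the others. *)
Lemma syt_lift (T : 'S_d) (x : 'I_d.+1) : corner_cell x ->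
  is_syt nu (lift_perm x ord_max T) = is_syt (remove_cell (row_ x)) T.
Proof.
move=> cx; have L y := lift_cell y cx.
have TL y : lift_perm x ord_max T (lift x y) = T y :> nat.
  by rewrite lift_perm_lift /= /bump leqNgt ltn_ord.
have Lr y z : same_row nu (lift x y) (lift x z) = same_row (remove_cell (row_ x)) y z.
  by rewrite /same_row (proj1 (L y)) (proj1 (L z)).
have Lc y z : same_col nu (lift x y) (lift x z) = same_col (remove_cell (row_ x)) y z.
  by rewrite /same_col (proj2 (L y)) (proj2 (L z)).
apply/forallP/forallP => h a; apply/forallP => b.
  have /forallP/(_ (lift x b)) := h (lift x a).
  by rewrite !TL Lr Lc !(proj1 (L _)) !(proj2 (L _)).
have [/eqP e1 l1] := andP cx.
case: (unliftP x b) => [b' ->|->]; last first.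
  case: (unliftP x a) => [a' ->|->]; last by rewrite !ltnn !andbF.
  by rewrite TL lift_perm_id ltn_ord !implybT.
case: (unliftP x a) => [a' ->|->].
  have /forallP/(_ b') := h a'.
  by rewrite !TL Lr Lc !(proj1 (L _)) !(proj2 (L _)).
set z := lift x b'; have ltz := col_lt nu_size z.
apply/andP; split; apply/implyP => /andP[/eqP e lt].
  by move: ltz; rewrite -e e1 ltnS leqNgt lt.
have := part_anti nu_sorted lt; move: ltz l1; rewrite -e => h1 h2 h3.
by have := leq_trans h1 (leq_trans h3 h2); rewrite ltnn.
Qed.

(** A standard tableau is determined by the corner containing its largest entry and
    by the tableau of the other entries. *)
Lemma num_syt_recr :
  num_syt d.+1 nu = (\sum_(i < size nu | corner i) num_syt d (remove_cell i))%N.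
Proof.
rewrite /num_syt -sum1_card.
rewrite (partition_big (fun T : 'S_d.+1 => (T^-1 ord_max)%g) (fun x : 'I_d.+1 => corner_cell x)); last first.
  by move=> T; rewrite inE => sT; apply: (syt_corner sT); rewrite permKV.
have ltrow (x : 'I_d.+1) : (row_ x < size nu)%N by apply: reshape_indexP; rewrite nu_size.
rewrite [LHS](partition_big (fun x : 'I_d.+1 => Ordinal (ltrow x)) (fun i => corner i)); last first.
  by move=> x; apply: corner_cell_row.
apply: eq_bigr => i ci.
have lti : ((part i).-1 < part i)%N by rewrite ltn_predL; apply: leq_ltn_trans ci.
have [x [rx cx]] := cell_exists nu_size lti.
have cornx : corner_cell x.
  by move: ci; rewrite /corner_cell rx cx /corner; move: (part i) (part i.+1) => A B; lia.
rewrite (big_pred1 x) => [|y /=]; last first.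
  apply/andP/eqP => [[cy /eqP/(congr1 val) /= ry]|->]; last first.
    by split=> //; apply/eqP/val_inj.
  apply: (cell_inj (la := nu)); rewrite ?ry ?rx // cx -ry.
  by case/andP: cy => /eqP -> .
rewrite -sum1_card (eq_bigl (fun T : 'S_d.+1 => (T x == ord_max) && is_syt nu T)); last first.
  move=> T; rewrite inE andbC; congr (_ && _).
  by rewrite -(inj_eq (@perm_inj _ T)) permKV eq_sym.
rewrite (reindex (lift_perm x ord_max)); last first.
  by apply: subon_bij (lift_perm_bij _ _) => w; rewrite !inE => /andP[].
by apply: eq_bigl => T; rewrite lift_perm_id eqxx /= syt_lift // rx inE.
Qed.

End Corner.

(** Both sides satisfy the same recursion: in [frob_dim_recr], lowering the
    beta-number of a row that does not end in a corner makes it equal to another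
    beta-number or is impossible, and the term vanishes. *)
Lemma num_syt_frob_dim d nu : sorted geq nu -> sumn nu = d ->
  frob_dim d (@beta_number nu (size nu)) = (num_syt d nu)%:R.
Proof.
elim: d nu => [|d IH] nu nus nud.
  have z0 r : nth 0%N nu r = 0%N.
    by move/eqP/natnseq0P: nud => ->; rewrite nth_nseq if_same.
  rewrite /num_syt (_ : [set T | _] = setT); last first.
    by apply/setP => T; rewrite !inE; apply/forallP => -[].
  rewrite cardsT card_Sn /frob_dim.
  have e0 (f g : {ffun 'I_0 -> 'I_(size nu)}) : f = g by apply/ffunP => -[].
  pose f0 : {ffun 'I_0 -> 'I_(size nu)} := ffun0 (card_ord 0).
  rewrite (big_pred1 f0) => [|f]; last by rewrite /= (e0 f f0) eqxx.
  rewrite /alt_coef (big_pred1 1%g) ?odd_perm1 // => w.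
  apply/forallP/eqP => [h|-> i]; last by rewrite ffunE big_ord0 perm1 /beta_number z0.
  apply/permP => i; rewrite perm1; apply: val_inj => /=.
  by have := h i; rewrite ffunE big_ord0 /beta_number z0 => /eqP.
rewrite frob_dim_recr (num_syt_recr nus nud) natr_sum [RHS]big_mkcond.
rewrite [RHS](reindex_inj rev_ord_inj); apply: eq_bigr => j _.
case: ifP => cj.
  have -> : (0 < beta_number nu j)%N by rewrite /beta_number ltn_addr // (leq_ltn_trans _ cj).
  rewrite mul1r -(IH (remove_cell nu (rev_ord j)) (remove_sorted nus cj) (remove_size nud cj)).
  have sz : size (remove_cell nu (rev_ord j)) = size nu by rewrite size_mkseq.
  have E : forall k (e : size nu = k),
     frob_dim d (fun i : 'I_(size nu) => beta_number nu i - (i == j))%N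
     = frob_dim d (@beta_number (remove_cell nu (rev_ord j)) k).
    move=> k e; case: _ / e; apply: frob_dim_eq => i.
    rewrite /beta_number nth_remove [rev_ord i == rev_ord j :> nat](inj_eq (inj_comp val_inj rev_ord_inj)).
    case: (eqVneq i j) => [->|_]; last by rewrite !subn0.
    by rewrite addnBAC // (leq_ltn_trans _ cj).
  exact: E (esym sz).
case: (posnP (beta_number nu j)) => [_|c0]; first by rewrite /= mul0r.
rewrite /= mul1r; case: j cj c0 => j ltj cj c0.
have e : nth 0%N nu (size nu - j.+1).+1 = nth 0%N nu (size nu - j.+1).
  apply/eqP; rewrite eqn_leq (part_anti nus (leqnSn _)) /=.
  by move: cj; rewrite /corner /= => /negbT; rewrite -leqNgt.
case: j ltj cj c0 e => [|j] ltj cj c0 e.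
  move: c0; rewrite /beta_number /= -e subn1 prednK // nth_default //.
apply: (@frob_dim_eq0 _ _ _ (Ordinal (ltnW ltj)) (Ordinal ltj)).
  by rewrite -val_eqE /= ltn_eqF.
rewrite /beta_number /= -!val_eqE /= eqxx [j == j.+1]ltn_eqF //.
have -> : (size nu - j.+1 = (size nu - j.+2).+1)%N by have := ltj; lia.
by rewrite e; lia.
Qed.

(** * Kronecker squares of staircases *)

Lemma frob_cast k k' (e : k = k') (b : 'I_k -> nat) (b' : 'I_k' -> nat) n (s : 'S_n) :
  (forall i, b i = b' (cast_ord e i)) -> frob_char b s = frob_char b' s.
Proof.
case: _ / e b' => b' eb; apply: eq_bigr => f _; apply: eq_alt_coef => // i.
by rewrite eb cast_ord_id.
Qed.

Lemma size_staircase k : size (staircase k) = k.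
Proof. by rewrite size_rev size_iota. Qed.

Lemma nth_staircase k i : (i < k)%N -> nth 0%N (staircase k) i = (k - i)%N.
Proof.
move=> lti; rewrite /staircase nth_rev size_iota // nth_iota; lia.
Qed.

Lemma sorted_staircase k : sorted geq (staircase k).
Proof.
apply/(sortedP 0%N) => i; rewrite size_staircase => lti.
by rewrite !nth_staircase //=; lia.
Qed.

Lemma sumn_staircase k : sumn (staircase k) = staircase_size k.
Proof.
rewrite /staircase sumn_rev sumnE -[1%N]addn0 iotaDl big_map.
by rewrite /staircase_size -sum_ord_nat big_ord_recl add0n -/(index_iota 0 k) -[k in iota 0 k]subn0 big_mkord.
Qed.

Lemma frob_staircase k n (s : 'S_n) :
  frob_char (@beta_number (staircase k) (size (staircase k))) s
  = frob_char (fun i : 'I_k => i.*2.+1) s.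
Proof.
apply: (frob_cast (e := size_staircase k)) => i.
have lti : (i < k)%N by rewrite -[X in (_ < X)%N](size_staircase k).
have e : nat_of_ord (rev_ord i) = (k - i.+1)%N.
  by rewrite /=; congr (_ - _)%N; apply: size_staircase.
rewrite /beta_number e nth_staircase; first by rewrite /=; lia.
by lia.
Qed.

Lemma kronecker_frob n la mu nu :
  sorted geq la -> sumn la = n -> sorted geq mu -> sumn mu = n ->
  sorted geq nu -> sumn nu = n ->
  n`!%:R * (kronecker n la mu nu)%:R
  = \sum_(s : 'S_n) frob_char (@beta_number la (size la)) s *
     frob_char (@beta_number mu (size mu)) s * frob_char (@beta_number nu (size nu)) s.
Proof.
move=> las lan mus mun nus nun; apply: (@intr_inj algC).
rewrite rmorphM !rmorph_nat kroneckerE cfdotE cardsT card_Sn /=.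
rewrite mulVKf ?pnatr_eq0 -?lt0n ?fact_gt0 // raddf_sum.
apply: eq_big => [s|s _]; first by rewrite inE.
rewrite cfunE !specht_char_frob // rmorph_int -!rmorphM //.
Qed.

Lemma kronecker_kron_poly d nu k : is_partition d nu ->
  (head 0 nu + d <= staircase_size k)%N -> (d <= k.+1)%N ->
  (kronecker (staircase_size k) (staircase k) (staircase k)
             ((staircase_size k - d)%N :: nu))%:R
  = (kron_poly d (@beta_number nu (size nu))).[k%:R].
Proof.
case/and3P => nus _ /eqP nud led ledk; set n := staircase_size k.
pose r := size nu; pose c := @beta_number nu r.
have sum_c : (\sum_j c j = d + 'C(r, 2))%N := sum_beta_number nud.
have ledn : (d <= n)%N by apply: leq_trans led; rewrite leq_addl.
have nus' : sorted geq ((n - d)%N :: nu).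
  move: nus led; case: (nu) => //= a s -> h; rewrite andbT /= /n; lia.
have nud' : sumn ((n - d)%N :: nu) = n by rewrite /= nud subnK.
rewrite -(@kron_polyE _ _ c n.+1) ?ltnS //.
suff : (kronecker n (staircase k) (staircase k) ((n - d)%N :: nu))%:R
  = \sum_(a < d.+1) \sum_(e <- words k) block_sum c n.+1 a k e :> int.
  by move=> <-; rewrite rmorph_nat.
apply: (@mulfI _ n`!%:R); first by rewrite pnatr_eq0 -lt0n fact_gt0.
rewrite kronecker_frob ?sorted_staircase ?sumn_staircase //.
under eq_bigr => s _ do rewrite !frob_staircase.
have bl (j : 'I_r) : @beta_number ((n - d)%N :: nu) r.+1 (lift ord_max j) = c j.
  rewrite /c /beta_number /= /bump leqNgt ltn_ord add0n subSS.
  have -> : (r - j = (r - j.+1).+1)%N by have := ltn_ord j; move: (j : nat) => j' ltj; lia.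
  by [].
have bm : @beta_number ((n - d)%N :: nu) r.+1 ord_max = (n - d + r)%N.
  by rewrite /beta_number /= subnn.
rewrite -(alt_array_split sum_c (ltnSn n) ledn bl bm) /=.
have := @burnside_content n n.+1 _ (fun m : {ffun ('I_k * 'I_k) * 'I_r.+1 -> nat} =>
     alt_coef delta (fun i => i.*2.+1) (row_sum (pair_margin m)) *
     alt_coef delta (fun i => i.*2.+1) (col_sum (pair_margin m)) *
     alt_coef delta (@beta_number ((n - d)%N :: nu) r.+1) (col_sum m)) (ltnSn n) => <-.
apply: eq_bigr => s _; rewrite /frob_char.
rewrite (@sum_pair_fixed _ _ _ s (fun m => alt_coef delta (fun i : 'I_k => i.*2.+1) m)
  (fun m => alt_coef delta (fun i : 'I_k => i.*2.+1) m)).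
rewrite (@sum_pair_fixed _ _ _ s
   (fun m => alt_coef delta (fun i : 'I_k => i.*2.+1) [ffun i => row_sum m i] *
             alt_coef delta (fun i : 'I_k => i.*2.+1) [ffun j => col_sum m j])
   (fun m => alt_coef delta (@beta_number ((n - d)%N :: nu) r.+1) m)).
apply: eq_bigr => F _; congr (_ * _ * _).
- by apply: eq_alt_coef => // i; rewrite ffunE.
- by apply: eq_alt_coef => // i; rewrite ffunE.
- by apply: eq_alt_coef => // i; rewrite ffunE.
Qed.

Lemma kron_poly_lead d nu : is_partition d nu ->
  (kron_poly d (@beta_number nu (size nu)))`_d = (num_syt d nu)%:R.
Proof.
case/and3P => nus _ /eqP nud; rewrite kron_poly_coef ?(sum_beta_number nud) //.
by rewrite frob1 num_syt_frob_dim // rmorph_nat.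
Qed.

(** The numbering of the cells is itself a standard tableau. *)
Lemma num_syt_gt0 d nu : sumn nu = d -> (0 < num_syt d nu)%N.
Proof.
move=> nud; apply/card_gt0P; exists 1%g; rewrite inE; apply/forallP => i; apply/forallP => j.
rewrite !perm1 /same_row /same_col.
have E (x : 'I_d) := reshape_indexK nu x.
apply/andP; split; apply/implyP => /andP[/eqP e lt].
  by rewrite -(E i) -(E j) /flatten_index e ltn_add2l.
rewrite -(E i) -(E j) /flatten_index !sumn_take.
apply: (@leq_trans (\sum_(t < (reshape_index nu i).+1) nth 0 nu t)%N).
  by rewrite big_ord_recr /= ltn_add2l (col_lt nud).
apply: leq_trans (leq_addr _ _).
by rewrite -(subnKC lt) big_split_ord /= leq_addr.
Qed.

Lemma size_kron_poly_eq d nu : is_partition d nu ->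
  size (kron_poly d (@beta_number nu (size nu))) = d.+1.
Proof.
move=> pnu; apply/eqP; rewrite eqn_leq size_kron_poly /= ltnNge; apply/negP => le.
have := kron_poly_lead pnu; rewrite nth_default // => /esym/eqP; rewrite pnatr_eq0.
by case/and3P: pnu => _ _ /eqP /num_syt_gt0; rewrite lt0n => /negbTE ->.
Qed.

Lemma lead_kron_poly d nu : is_partition d nu ->
  lead_coef (kron_poly d (@beta_number nu (size nu))) = (num_syt d nu)%:R.
Proof. by move=> pnu; rewrite lead_coefE size_kron_poly_eq // kron_poly_lead. Qed.

(** * Interpolation and conclusion *)

From mathcomp Require Import all_classical all_reals.
From mathcomp Require Import topology normedtype derive.
Import numFieldNormedType.Exports.

Section Interpolation.
Variable R : realType.

(** The maximum of 0 and [1 - `|y|], in a form that is visibly continuous. *)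
Definition hat (y : R) : R := ((1 - `|y|) + `|1 - `|y| |) / 2.

Lemma hat_far y : 1 <= `|y| -> hat y = 0.
Proof.
move=> h; rewrite /hat (@ler0_norm _ (1 - `|y|)) ?subrr ?mul0r //.
by rewrite subr_le0.
Qed.

Lemma hat_near y : `|y| <= 1 -> hat y = 1 - `|y|.
Proof.
move=> h; rewrite /hat (@ger0_norm _ (1 - `|y|)) ?subr_ge0 //.
lra.
Qed.

Variables (q : {poly rat}) (C : nat) (u : nat -> rat).
Hypothesis u_far : forall i, (C <= i)%N -> u i = 0.

(** The hats are centred at integers: of the values of the polynomial at integers,
    the i-th hat changes only the one at i. *)
Definition interp (y : R) : R :=
  (map_poly ratr q).[y] + \sum_(i < C.+2) ratr (u i) * hat (y - i%:R).

Definition piece (i : nat) : {poly rat} :=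
  q + u i *: (1 - ('X - i%:R%:P)) + u i.+1 *: ('X - i%:R%:P).

Lemma interp_far y : C%:R <= y -> interp y = (map_poly ratr q).[y].
Proof.
move=> hy; rewrite /interp big1 ?addr0 // => i _.
case: (ltnP i C) => lti; last by rewrite u_far // raddf0 mul0r.
rewrite hat_far ?mulr0 //; apply: le_trans (ler_norm _).
have : (i.+1%:R : R) <= C%:R by rewrite ler_nat.
by rewrite -natr1; lra.
Qed.

Lemma interp_piece i y : (i <= C)%N -> i%:R <= y -> (i < C)%N ==> (y <= i.+1%:R) ->
  interp y = (map_poly ratr (piece i)).[y].
Proof.
move=> leiC hy; case: (ltnP i C) => ltiC /= hy'; last first.
  have -> : i = C by apply/eqP; rewrite eqn_leq leiC.
  rewrite interp_far /piece ?u_far // ?scale0r ?addr0 //.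
  by apply: le_trans hy; rewrite ler_nat.
have y1 : y <= i%:R + 1 by rewrite natr1.
rewrite /interp /piece !rmorphD /= !hornerD -addrA; congr (_ + _).
rewrite !map_polyZ !hornerZ rmorphB /= rmorph1 map_polyXsubC !hornerE rmorph_nat.
have lt1 : (i < C.+2)%N by rewrite ltnW // !ltnS ltnW.
have lt2 : (i.+1 < C.+2)%N by rewrite !ltnS.
rewrite (bigD1 (Ordinal lt1)) //= (bigD1 (Ordinal lt2)) //=; last first.
  by rewrite -val_eqE /= gtn_eqF.
rewrite big1 ?addr0 => [|j /andP[n1 n2]]; last first.
  rewrite hat_far ?mulr0 //.
  rewrite -!val_eqE /= in n1 n2.
  case: (ltngtP j i) n1 => // ltji _.
    apply: le_trans (ler_norm _).
    have : (j.+1%:R : R) <= i%:R by rewrite ler_nat.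
    by rewrite -natr1; lra.
  have ltj : (i.+1 < j)%N by rewrite ltn_neqAle eq_sym n2.
  rewrite -normrN; apply: le_trans (ler_norm _).
  have : (i.+2%:R : R) <= j%:R by rewrite ler_nat.
  by rewrite -natr1 -natr1; lra.
congr (_ * _ + _ * _).
  rewrite hat_near ger0_norm ?subr_ge0 //; lra.
have e : `|y - i.+1%:R| = i.+1%:R - y.
  by rewrite ler0_norm ?opprB // subr_le0.
by rewrite hat_near e -natr1; lra.
Qed.

Lemma interp_nat k : (k < C)%N -> interp k%:R = (map_poly ratr q).[k%:R] + ratr (u k).
Proof.
move=> ltk; have lek : (k < C)%N ==> (k%:R <= k.+1%:R :> R) by rewrite ltk /= ler_nat.
rewrite (interp_piece (ltnW ltk) (lexx _) lek).
rewrite /piece !rmorphD /= !hornerD !map_polyZ !hornerZ rmorphB /= rmorph1 map_polyXsubC.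
by rewrite !hornerE rmorph_nat subrr subr0 mulr0 addr0 mulr1.
Qed.

Lemma hat_continuous : continuous hat.
Proof.
have c1 (y : R) : {for y, continuous (fun y : R => 1 - `|y|)}.
  by apply: continuousB; [exact: cst_continuous | exact: norm_continuous].
have c2 (y : R) : {for y, continuous (fun y : R => `|1 - `|y| |)}.
  by apply: (continuous_comp (c1 y)); exact: norm_continuous.
move=> y; have c3 := continuousD (c1 y) (c2 y).
have c4 := @cst_continuous R R 2^-1 y.
exact: (continuousM c3 c4 : {for y, continuous hat}).
Qed.

Lemma interp_continuous : continuous interp.
Proof.
move=> y; apply: continuousD; first exact: continuous_horner.
elim: (C.+2) => [|N IH].
  have -> : (fun y : R => \sum_(i < 0) ratr (u i) * hat (y - i%:R)) = cst 0.
    by apply/funext => z; rewrite big_ord0.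
  exact: cst_continuous.
have -> : (fun y : R => \sum_(i < N.+1) ratr (u i) * hat (y - i%:R)) =
   (fun y : R => \sum_(i < N) ratr (u i) * hat (y - i%:R) + ratr (u N) * hat (y - N%:R)).
  by apply/funext => z; rewrite big_ord_recr.
apply: continuousD => //; apply: continuousM; first exact: cst_continuous.
apply: (@continuous_comp _ _ _ (fun y : R => y - N%:R) hat); last exact: hat_continuous.
by apply: continuousB; [exact: cvg_id | exact: cst_continuous].
Qed.

Lemma interp_piecewise : rational_piecewise_poly interp.
Proof.
split; first by apply: continuous_subspaceT; exact: interp_continuous.
exists C.+1, (fun i => if (i <= C)%N then i%:R%:E else +oo%E), piece; split=> //.
- by rewrite ltnn.
- move=> i; rewrite ltnS => leiC; rewrite leiC.
  by case: ltnP => _; rewrite ?ltry // lte_fin ltr_nat.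
move=> i; rewrite ltnS => leiC y; rewrite leiC lee_fin => /andP[hy hy'].
apply: interp_piece => //; apply/implyP => ltiC.
by move: hy'; rewrite ltiC lee_fin.
Qed.

End Interpolation.

Lemma t_bound_ge0 (R : realType) d nu : 0 <= t_bound R d nu.
Proof.
rewrite ceil_ge0; apply: (@lt_le_trans _ _ 0); first by rewrite ltrN10.
rewrite divr_ge0 // addrC subr_ge0 -[1 in X in X <= _]sqrtr1 ler_wsqrtr //.
by rewrite lerDl mulr_ge0.
Qed.

Lemma t_bound_le (R : realType) d nu k : t_bound R d nu <= k%:Z ->
  (head 0 nu + d <= staircase_size k)%N.
Proof.
rewrite /t_bound ceil_le_int -pmulrn ler_pdivrMr // => h.
set m := (head 0%N nu + d)%N in h *.
have h1 : Num.sqrt (1 + 8 * m%:R : R) <= (k.*2.+1)%:R.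
  by rewrite -[k.*2.+1]addn1 natrD -muln2 natrM; lra.
have : 1 + 8 * m%:R <= (k.*2.+1)%:R ^+ 2 :> R.
  rewrite -[X in X <= _]sqr_sqrtr; last by rewrite addr_ge0 // mulr_ge0.
  by rewrite ler_pXn2r // nnegrE ?sqrtr_ge0.
rewrite -natrM -natrX nat1r ler_nat.
have := mul_bin_diag k.+1 1; rewrite bin1 /= /staircase_size.
move: ('C(k.+1, 2)) => B; rewrite expnS expn1; nia.
Qed.

Theorem theorem8p10 (R : realType) (d : nat) (nu : seq nat)
    (hnu : is_partition d nu) :
  exists s : R -> R,
    [/\ rational_piecewise_poly s,
        forall k : nat, (0 < k)%N -> t_bound R d nu <= k%:Z ->
          (kronecker (staircase_size k) (staircase k) (staircase k)
             ((staircase_size k - d)%N :: nu))%:R = s k%:R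
      & exists q : {poly R},
          [/\ size q = d.+1,
              lead_coef q = (num_syt d nu)%:R
            & forall y : R, (c_bound R d nu)%:~R <= y -> s y = q.[y]]].
Proof.
pose q := kron_poly d (@beta_number nu (size nu)).
pose g k : rat := (kronecker (staircase_size k) (staircase k) (staircase k)
             ((staircase_size k - d)%N :: nu))%:R.
have c0 : 0 <= c_bound R d nu by rewrite le_max t_bound_ge0 orbT.
(* The polynomial is corrected at the integers below C. *)
pose C := `|c_bound R d nu|%N.
have CE : C%:Z = c_bound R d nu by rewrite gez0_abs.
pose u k := if (k < C)%N then g k - q.[k%:R] else 0.
have u_far i : (C <= i)%N -> u i = 0 by rewrite /u ltnNge => ->.
exists (interp q C u); split.
- exact: interp_piecewise.
- move=> k k0 tk; have led := t_bound_le tk.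
  rewrite -[LHS](ratr_nat R) -/(g k).
  have qk : ratr q.[k%:R] = (map_poly ratr q).[k%:R] :> R.
    by rewrite -horner_map /= ratr_nat.
  case: (ltnP k C) => ltk.
    by rewrite interp_nat // /u ltk rmorphB /= qk addrC subrK.
  rewrite interp_far ?ler_nat // -qk; congr (ratr _).
  apply: kronecker_kron_poly => //.
  have : d%:Z - 1 <= k%:Z.
    apply: (@le_trans _ _ (c_bound R d nu)); first by rewrite le_max lexx.
    by rewrite -CE lez_nat.
  lia.
exists (map_poly ratr q); split.
- by rewrite size_map_poly size_kron_poly_eq.
- by rewrite lead_coef_map lead_kron_poly //= ratr_nat.
move=> y hy; apply: interp_far => //.
by rewrite -CE in hy.
Qed.
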